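(* Let $\mathcal{I}=\{0,\dots,M-1\}$ be a finite alphabet, let $\{S_i\}_{i\in\mathcal{I}}$ be contracting similarities of $\mathbb{R}^n$, each mapping $[0,1]^n$ into itself, let $A$ be an irreducible $M\times M$ transition matrix with entries in $\{0,1\}$, and let $s=\dim_{\mathrm H}F_A$. Then $\mathcal{H}^s(F_A)>0$ if and only if $F_A$ is Ahlfors regular. Moreover, for every $\mathbf{i}\in\mathcal{I}^*$, $\mathcal{H}^s(F_A^{\mathbf{i}})>0$ if and only if $F_A^{\mathbf{i}}$ is Ahlfors regular.
   Context: $\mathcal{H}^s$ is $s$-dimensional Hausdorff measure on $\mathbb{R}^n$ (normalized as the limit as $\delta\to0$ of infima of $\sum_k\mathrm{diam}(U_k)^s$ over countable covers by sets of diameter at most $\delta$), $\dim_{\mathrm H}$ is Hausdorff dimension. Ahlfors regularity: a nonempty bounded set $F\subseteq\mathbb{R}^n$ with Hausdorff dimension $t$ is Ahlfors regular if there is a constant $c\ge1$ such that for all $r\in(0,\mathrm{diam}(F)]$ and $x\in F$, $c^{-1}r^t\le\mathcal{H}^t(F\cap B(x,r))\le c\,r^t$, where $B(x,r)$ is the ball of centre $x$ and radius $r$. Symbolic setting: $\Sigma=\mathcal{I}^{\{0,1,2,\dots\}}$ is the set of infinite sequences $\alpha=(\alpha_0,\alpha_1,\dots)$ over $\mathcal{I}$; $\alpha|_k=(\alpha_0,\dots,\alpha_{k-1})$. $\mathcal{I}^*=\bigcup_{k\ge1}\mathcal{I}^k$ is the set of finite (nonempty) words. For $\mathbf{i}\in\mathcal{I}^k$,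 $[\mathbf{i}]=\{\alpha\in\Sigma:\alpha|_k=\mathbf{i}\}$. $\Sigma_A=\{\alpha\in\Sigma: A_{\alpha_l,\alpha_{l+1}}=1\text{ for all }l\ge0\}$. $A$ is irreducible if for all $i,j\in\mathcal{I}$ there is a positive integer $m$ with $(A^m)_{i,j}>0$. Each $S_i$ is a similarity with contraction ratio $r_i\in(0,1)$; for $\mathbf{i}=(i_0,\dots,i_{k-1})$, $S_{\mathbf{i}}=S_{i_0}\circ\cdots\circ S_{i_{k-1}}$. The coding map $\Pi:\Sigma\to[0,1]^n$ is given by $\{\Pi(\alpha)\}=\bigcap_{k\ge1}S_{\alpha|_k}([0,1]^n)$. $F_A=\Pi(\Sigma_A)$ and $F_A^{\mathbf{i}}=\Pi(\Sigma_A\cap[\mathbf{i}])$ (possibly empty). No separation condition is assumed. *)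

(* Defs.v *)
From mathcomp Require Import all_boot all_order all_algebra.
From mathcomp Require Import all_classical all_reals all_analysis.

Set Implicit Arguments.
Unset Strict Implicit.
Unset Printing Implicit Defensive.

Import Order.TTheory GRing.Theory Num.Theory.
Import numFieldNormedType.Exports.

Local Open Scope classical_set_scope.
Local Open Scope ring_scope.

(* The norm the library puts on row vectors is the sup norm. *)
Definition edist (R : realType) (n : nat) (x y : 'rV[R]_n) : R :=
  Num.sqrt (\sum_(i < n) (x 0 i - y 0 i) ^+ 2).

Definition eball (R : realType) (n : nat) (x : 'rV[R]_n) (r : R) :
  set 'rV[R]_n := [set y | edist x y <= r].

(* The extra 0 makes the diameter of the empty set 0 rather than -oo. *)
Definition diam (R : realType) (n : nat) (U : set 'rV[R]_n) : \bar R :=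
  ereal_sup (0%E |` [set (edist x.1 x.2)%:E | x in U `*` U]).

(* diam(U)^s. The case distinction matters only for s = 0: a nonempty set
   contributes 1 (0 `^ 0 = 1 in the library) and the empty set contributes 0,
   so that H^0 is the counting measure. *)
Definition diam_pow (R : realType) (n : nat) (s : R) (U : set 'rV[R]_n) :
  \bar R := if U == set0 then 0%E else poweR (diam U) s.

(* Countable covers are sequences; finite ones are padded with empty sets. *)
Definition is_cover (R : realType) (n : nat) (delta : R) (E : set 'rV[R]_n)
    (U : nat -> set 'rV[R]_n) : Prop :=
  E `<=` \bigcup_k U k /\ forall k, (diam (U k) <= delta%:E)%E.

Definition hausdorff_delta (R : realType) (n : nat) (s delta : R)
    (E : set 'rV[R]_n) : \bar R :=
  ereal_inf [set (\sum_(0 <= k <oo) diam_pow s (U k))%E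
            | U in is_cover delta E].

Definition hausdorff_measure (R : realType) (n : nat) (s : R)
    (E : set 'rV[R]_n) : \bar R :=
  lim (hausdorff_delta s delta E @[delta --> 0^'+]).

(* The set below contains every s > n, so this is a genuine infimum. *)
Definition hausdorff_dim (R : realType) (n : nat) (E : set 'rV[R]_n) : R :=
  inf [set s : R | 0 <= s /\ hausdorff_measure s E = 0%E].

Definition ahlfors_regular (R : realType) (n : nat) (F : set 'rV[R]_n) : Prop :=
  let t := hausdorff_dim F in
  [/\ F !=set0, (diam F < +oo)%E &
    exists2 c : R, 1 <= c &
      forall (r : R) (x : 'rV[R]_n), 0 < r -> (r%:E <= diam F)%E -> F x ->
        ((c^-1 * r `^ t)%:E <= hausdorff_measure t (F `&` eball x r))%E /\
        (hausdorff_measure t (F `&` eball x r) <= (c * r `^ t)%:E)%E].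

Definition unit_cube (R : realType) (n : nat) : set 'rV[R]_n :=
  [set x | forall i, 0 <= x 0 i <= 1].

Definition contracting_similarity (R : realType) (n : nat) (r : R)
    (f : 'rV[R]_n -> 'rV[R]_n) : Prop :=
  0 < r < 1 /\ forall x y, edist (f x) (f y) = r * edist x y.

Definition irreducible_mx (M : nat) (A : 'M[nat]_M) : Prop :=
  forall i j, exists m : nat, (0 < m)%N /\ (0 < (A ^+ m) i j)%N.

Definition prefix_word (M : nat) (alpha : nat -> 'I_M) (k : nat) : seq 'I_M :=
  mkseq alpha k.

Definition cylinder (M : nat) (w : seq 'I_M) : set (nat -> 'I_M) :=
  [set alpha | prefix_word alpha (size w) = w].

Definition subshift (M : nat) (A : 'M[nat]_M) : set (nat -> 'I_M) :=
  [set alpha | forall l : nat, A (alpha l) (alpha l.+1) = 1%N].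

Definition word_map (R : realType) (n M : nat)
    (S : 'I_M -> 'rV[R]_n -> 'rV[R]_n) (w : seq 'I_M) : 'rV[R]_n -> 'rV[R]_n :=
  foldr (fun i f => S i \o f) id w.

(* The unique x with {x} = \bigcap_(k >= 1) S_(alpha|_k) ([0,1]^n). It exists
   when the S_i are contracting similarities mapping the cube into itself;
   otherwise the value may be arbitrary. *)
Definition coding_map (R : realType) (n M : nat)
    (S : 'I_M -> 'rV[R]_n -> 'rV[R]_n) (alpha : nat -> 'I_M) : 'rV[R]_n :=
  get [set x | \bigcap_(k in [set k | (1 <= k)%N])
                 (word_map S (prefix_word alpha k) @` @unit_cube R n) = [set x]].

Definition subshift_set (R : realType) (n M : nat)
    (S : 'I_M -> 'rV[R]_n -> 'rV[R]_n) (A : 'M[nat]_M) : set 'rV[R]_n :=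
  coding_map S @` subshift A.

Definition subshift_piece (R : realType) (n M : nat)
    (S : 'I_M -> 'rV[R]_n -> 'rV[R]_n) (A : 'M[nat]_M) (w : seq 'I_M) :
  set 'rV[R]_n := coding_map S @` (subshift A `&` cylinder w).

(* Main.v *)
(** Let [s] be the dimension of the limit set.  Fix a letter [a], let [G] be the
    part of the limit set coded by the sequences starting with [a], and call a
    word a loop if it can be prepended to all these sequences, so that it maps
    [G] into [G].

    If finitely many loops [w] send [G] to sets at positive mutual distance,
    then the sum of the [ratio w `^ s] is at most 1.  Otherwise the sum is still
    at least 1 for some exponent [t > s]; a set of small diameter meets at most
    one of the copies of [G], so a cover of [G] that is cheap for [t] is, after
    rescaling, at least as cheap on one of the copies.  Iterating, it stays
    cheap on copies so small that they lie in a single set of the cover, which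
    is absurd; hence [G] has positive measure for some [t > s].

    A greedy choice shows conversely that every subset [E] of [G] has, at
    arbitrarily small scales, separated copies of [G] close to [E] whose sum
    bounds the premeasure of [E] up to a constant.

    Suppose now that the measure of the part of [G] in a ball [B] is larger than
    [K * rho `^ s], so that [B] contains separated copies [v] of [G] with sum at
    least [K' * rho `^ s].  Take a family of loops [p] of almost maximal sum
    such that the loops [p ++ v] are separated.  The packing inequality bounds
    its sum by [(K' * rho `^ s)^-1], so the images of [B] under the [p] cost only
    [O(1 / K')], and by maximality what they leave of [G] is negligible.  As [G]
    has positive premeasure, [K'] is bounded.

    The lower bound holds because, by irreducibility, each ball centred in the
    limit set contains a copy of [G] of comparable size. *)

Require Import Defs.
From mathcomp Require Import all_boot all_order all_algebra.
From mathcomp Require Import all_classical all_reals all_analysis.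
From mathcomp Require Import zify ring lra.
Import Order.TTheory GRing.Theory Num.Theory.
Import numFieldNormedType.Exports.
(* [edist] is also the extended distance of MathComp-Analysis. *)
Import Defs.
Local Open Scope classical_set_scope.
Local Open Scope ring_scope.

Set Implicit Arguments.
Unset Strict Implicit.
Unset Printing Implicit Defensive.

(** * Euclidean distance and diameter *)

Section Euclidean.
Context {R : realType} {n : nat}.
Implicit Types (x y z : 'rV[R]_n) (U E : set 'rV[R]_n).

Lemma edist_ge0 x y : 0 <= edist x y.
Proof. exact: sqrtr_ge0. Qed.

Lemma edist_sym x y : edist x y = edist y x.
Proof.
by rewrite /edist; congr Num.sqrt; apply: eq_bigr => i _; rewrite -sqrrN opprB.
Qed.

(** Cauchy-Schwarz, by Lagrange's identity: the double sum of the squares of [a i * b j - a j * b i]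
    is twice the difference of the squared sides. *)
Lemma sum_mul_le_sqrt (a b : 'I_n -> R) :
  \sum_i a i * b i <=
  Num.sqrt (\sum_i a i ^+ 2) * Num.sqrt (\sum_i b i ^+ 2).
Proof.
rewrite -sqrtrM; last by apply: sumr_ge0 => i _; exact: sqr_ge0.
apply: le_trans (ler_norm _) _; rewrite -sqrtr_sqr ler_wsqrtr//.
have : 0 <= \sum_i \sum_j (a i * b j - a j * b i) ^+ 2.
  by apply: sumr_ge0 => i _; apply: sumr_ge0 => j _; exact: sqr_ge0.
have -> : \sum_i \sum_j (a i * b j - a j * b i) ^+ 2 =
    (\sum_i a i ^+ 2) * (\sum_i b i ^+ 2) *+ 2 - (\sum_i a i * b i) ^+ 2 *+ 2.
  transitivity (\sum_i (a i ^+ 2 * (\sum_j b j ^+ 2) +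
      (b i ^+ 2 * (\sum_j a j ^+ 2) + - 2 * (a i * b i) * (\sum_j a j * b j)))).
    apply: eq_bigr => i _; rewrite !mulr_sumr -!big_split/=.
    by apply: eq_bigr => j _; ring.
  by rewrite !big_split/= -!mulr_suml -mulr_sumr; ring.
rewrite -mulrnBl pmulrn_lge0// subr_ge0//.
Qed.

Lemma edist_triangle y x z : edist x z <= edist x y + edist y z.
Proof.
rewrite -ler_sqr ?nnegrE ?addr_ge0 ?edist_ge0//.
rewrite sqrrD !sqr_sqrtr; try by apply: sumr_ge0 => i _; exact: sqr_ge0.
rewrite -addrA [X in _ + X]addrC addrA.
apply: (@le_trans _ _ (\sum_(i < n) (x 0 i - y 0 i) ^+ 2 +
  \sum_(i < n) (y 0 i - z 0 i) ^+ 2 +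
  (\sum_i (x 0 i - y 0 i) * (y 0 i - z 0 i)) *+ 2)).
  rewrite -sumrMnl -!big_split/= le_eqVlt; apply/orP; left; apply/eqP.
  by apply: eq_bigr => i _; ring.
by rewrite lerD2l lerMn2r/= sum_mul_le_sqrt.
Qed.

Lemma le_coord_edist x y i : `|x 0 i - y 0 i| <= edist x y.
Proof.
rewrite -sqrtr_sqr ler_wsqrtr// (bigD1 i)//= lerDl.
by apply: sumr_ge0 => j _; exact: sqr_ge0.
Qed.

Lemma edist_eq0 x y : edist x y = 0 -> x = y.
Proof.
move=> xy0; apply/rowP => i; apply/eqP; rewrite -subr_eq0 -normr_eq0.
by rewrite eq_le normr_ge0 andbT -xy0 le_coord_edist.
Qed.

Lemma edist_le_norm x y (e : R) : 0 <= e ->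
  (forall i, `|x 0 i - y 0 i| <= e) -> edist x y <= Num.sqrt n%:R * e.
Proof.
move=> e0 xye; rewrite -[X in _ * X]ger0_norm// -sqrtr_sqr -sqrtrM// ler_wsqrtr//.
rewrite mulr_natl -[X in _ *+ X]card_ord -sumr_const ler_sum// => i _.
by rewrite -real_normK ?num_real// lerXn2r ?nnegrE.
Qed.

(** The Euclidean diameter of the cube plus 1; the summand keeps it positive when [n = 0]. *)
Definition cube_bound : R := Num.sqrt n%:R + 1.

Lemma cube_bound_ge1 : 1 <= cube_bound.
Proof. by rewrite lerDr sqrtr_ge0. Qed.

Lemma edist_cube x y : unit_cube x -> unit_cube y -> edist x y <= cube_bound.
Proof.
move=> cx cy; apply: (@le_trans _ _ (Num.sqrt n%:R * 1)).
  apply: edist_le_norm => // i.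
  by have /andP[? ?] := cx i; have /andP[? ?] := cy i; rewrite ler_norml; lra.
by rewrite mulr1 lerDl.
Qed.

Local Open Scope ereal_scope.

Lemma diam_ge0 U : 0 <= diam U.
Proof. by apply: ereal_sup_ubound; left. Qed.

Lemma le_diam U x y : U x -> U y -> (edist x y)%:E <= diam U.
Proof. by move=> Ux Uy; apply: ereal_sup_ubound; right; exists (x, y). Qed.

Lemma diam_le U (d : \bar R) : 0 <= d ->
  (forall x y, U x -> U y -> (edist x y)%:E <= d) -> diam U <= d.
Proof.
move=> d0 Ud; apply: ge_ereal_sup => _ [->//|[[x y] [Ux Uy] <-]] /=.
exact: Ud.
Qed.

Lemma diam_pow_ge0 s U : 0 <= diam_pow s U.
Proof. by rewrite /diam_pow; case: ifP => // _; exact: poweR_ge0. Qed.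

Lemma diam_pow_set0 s : diam_pow s (set0 : set 'rV[R]_n) = 0.
Proof. by rewrite /diam_pow eqxx. Qed.

Lemma diam_pow_neq0 s U : U !=set0 -> diam_pow s U = poweR (diam U) s.
Proof. by rewrite /diam_pow; case: eqVneq => // -> /set0P; rewrite eqxx. Qed.

Lemma diam_powE s U : (0 < s)%R -> diam_pow s U = poweR (diam U) s.
Proof.
move=> s0; rewrite /diam_pow; case: eqVneq => // ->.
suff -> : diam (set0 : set 'rV[R]_n) = 0 by rewrite poweR0r// gt_eqF.
by apply/eqP; rewrite eq_le diam_ge0 andbT diam_le.
Qed.

Lemma le_poweR s (u v : \bar R) : (0 <= s)%R -> 0 <= u -> u <= v ->
  poweR u s <= poweR v s.
Proof.
move=> s0 u0 uv; apply: gt0_ler_poweR => //; rewrite in_itv/= ?leey ?u0//.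
by rewrite (le_trans u0 uv).
Qed.

Lemma diam_pow_le s U (d : R) : (0 <= s)%R -> (0 <= d)%R ->
  (forall x y, U x -> U y -> (edist x y <= d)%R) ->
  diam_pow s U <= (d `^ s)%:E.
Proof.
move=> s0 d0 Ud; rewrite /diam_pow; case: ifP => _; first by rewrite lee_fin powR_ge0.
by rewrite -poweR_EFin le_poweR ?diam_ge0// diam_le// => x y Ux Uy; rewrite lee_fin Ud.
Qed.

End Euclidean.

(** * Hausdorff measure and dimension *)

Section HausdorffMeasure.
Context {R : realType} {n : nat}.
Implicit Types (x y z : 'rV[R]_n) (U E A B : set 'rV[R]_n) (s t d : R).
Local Open Scope ereal_scope.

Lemma hausdorff_delta_ge0 s d E : 0 <= hausdorff_delta s d E.
Proof.
apply: le_ereal_inf_tmp => _ [U _ <-].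
by apply: nneseries_ge0 => k _ _; exact: diam_pow_ge0.
Qed.

Lemma hausdorff_delta_anti s E d d' : (d <= d')%R ->
  hausdorff_delta s d' E <= hausdorff_delta s d E.
Proof.
move=> dd'; apply: le_ereal_inf_tmp => _ [U [EU Ud] <-].
apply: ereal_inf_lbound; exists U => //; split => // k.
by rewrite (le_trans (Ud k))// lee_fin.
Qed.

Lemma hausdorff_measureE s E :
  hausdorff_measure s E =
  ereal_sup ((fun d => hausdorff_delta s d E) @` [set` Interval (BRight 0%R) +oo%O]).
Proof.
apply: cvg_lim => //; apply: nonincreasing_at_right_cvge => // x y _ _ xy.
exact: hausdorff_delta_anti.
Qed.

Lemma hausdorff_delta_le s d E : (0 < d)%R ->
  hausdorff_delta s d E <= hausdorff_measure s E.
Proof.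
move=> d0; rewrite hausdorff_measureE; apply: ereal_sup_ubound; exists d => //=.
by rewrite in_itv/= d0.
Qed.

Lemma hausdorff_measure_le s E (c : \bar R) :
  (forall d, (0 < d)%R -> hausdorff_delta s d E <= c) ->
  hausdorff_measure s E <= c.
Proof.
move=> Ec; rewrite hausdorff_measureE; apply: ge_ereal_sup => _ [d/= + <-].
by rewrite in_itv/= andbT; exact: Ec.
Qed.

Lemma hausdorff_measure_gt s E (c : \bar R) : c < hausdorff_measure s E ->
  exists2 d, (0 < d)%R & c < hausdorff_delta s d E.
Proof.
rewrite hausdorff_measureE => /ereal_sup_gt[_ [d/= + <-] cd].
by rewrite in_itv/= andbT; exists d.
Qed.

Lemma hausdorff_measure_ge0 s E : 0 <= hausdorff_measure s E.
Proof.
by apply: le_trans (hausdorff_delta_le s E ltr01); exact: hausdorff_delta_ge0.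
Qed.

Lemma hausdorff_delta_sub s d A B : A `<=` B ->
  hausdorff_delta s d A <= hausdorff_delta s d B.
Proof.
move=> AB; apply: le_ereal_inf_tmp => _ [U [EU Ud] <-].
by apply: ereal_inf_lbound; exists U => //; split => //; exact: subset_trans EU.
Qed.

Lemma hausdorff_measure_sub s A B : A `<=` B ->
  hausdorff_measure s A <= hausdorff_measure s B.
Proof.
move=> AB; apply: hausdorff_measure_le => d d0.
exact: le_trans (hausdorff_delta_sub s d AB) (hausdorff_delta_le s B d0).
Qed.

Lemma hausdorff_measure_sub0 s A B : A `<=` B ->
  hausdorff_measure s B = 0 -> hausdorff_measure s A = 0.
Proof.
move=> AB B0; apply/eqP; rewrite eq_le hausdorff_measure_ge0 andbT -B0.
exact: hausdorff_measure_sub.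
Qed.

Lemma hausdorff_delta_diam_pow s d E : (0 <= d)%R -> diam E <= d%:E ->
  hausdorff_delta s d E <= diam_pow s E.
Proof.
move=> d0 Ed; apply: ge_ereal_inf.
exists (\sum_(0 <= k <oo) diam_pow s (if k == 0%N then E else set0)).
  exists (fun k => if k == 0%N then E else set0) => //; split.
    by move=> x Ex; exists 0%N.
  by case=> [//|k] /=; rewrite diam_le.
rewrite (nneseriesD1 (n := 0%N))//=; last by move=> k _; exact: diam_pow_ge0.
rewrite eseries0 ?adde0// => -[|k] _ //= _; exact: diam_pow_set0.
Qed.

Lemma hausdorff_delta_bounded s d d' E : (0 <= s)%R -> (0 <= d)%R -> (d <= d')%R ->
  (forall x y, E x -> E y -> (edist x y <= d)%R) ->
  hausdorff_delta s d' E <= (d `^ s)%:E.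
Proof.
move=> s0 d0 dd' Ed; apply: le_trans (diam_pow_le s0 d0 Ed).
apply: le_trans (hausdorff_delta_anti s E dd') _.
by apply: hausdorff_delta_diam_pow => //; apply: diam_le => // x y Ex Ey; rewrite lee_fin Ed.
Qed.

Lemma hausdorff_delta_set0 s d : (0 <= d)%R -> hausdorff_delta s d (set0 : set 'rV[R]_n) = 0.
Proof.
move=> d0; apply/eqP; rewrite eq_le hausdorff_delta_ge0 andbT.
rewrite -(diam_pow_set0 (n := n) s) hausdorff_delta_diam_pow// diam_le//.
Qed.

Lemma hausdorff_measure_set0 s : hausdorff_measure s (set0 : set 'rV[R]_n) = 0.
Proof.
apply/eqP; rewrite eq_le hausdorff_measure_ge0 andbT hausdorff_measure_le// => d d0.
by rewrite hausdorff_delta_set0// ltW.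
Qed.

Lemma hausdorff_deltaU s d A B :
  hausdorff_delta s d (A `|` B) <= hausdorff_delta s d A + hausdorff_delta s d B.
Proof.
have [Afin|] := boolP (hausdorff_delta s d A < +oo); last first.
  rewrite -leNgt leye_eq => /eqP ->.
  rewrite addye ?leey//; apply/eqP => B0.
  by have := hausdorff_delta_ge0 s d B; rewrite B0.
have [Bfin|] := boolP (hausdorff_delta s d B < +oo); last first.
  rewrite -leNgt leye_eq => /eqP ->.
  rewrite addey ?leey//; apply/eqP => B0.
  by have := hausdorff_delta_ge0 s d A; rewrite B0.
have {}Afin : hausdorff_delta s d A \is a fin_num.
  by rewrite ge0_fin_numE// hausdorff_delta_ge0.
have {}Bfin : hausdorff_delta s d B \is a fin_num.
  by rewrite ge0_fin_numE// hausdorff_delta_ge0.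
apply/lee_addgt0Pr => e e0.
have e20 : (0 < e / 2)%R by rewrite divr_gt0.
have [_ [U [AU Ud] <-] Ue] := lb_ereal_inf_adherent e20 Afin.
have [_ [V [BV Vd] <-] Ve] := lb_ereal_inf_adherent e20 Bfin.
rewrite [in e%:E](splitr e) EFinD addeACA.
apply: (le_trans _ (leeD (ltW Ue) (ltW Ve))).
(* Interleaving merges the two covers into one sequence. *)
pose W k := if odd k then V k./2 else U k./2.
apply: ge_ereal_inf; exists (\sum_(0 <= k <oo) diam_pow s (W k)).
  exists W => //; split; last by rewrite /W => k; case: ifP.
  move=> x [/AU[k _ Ukx]|/BV[k _ Vkx]].
    by exists k.*2 => //; rewrite /W odd_double doubleK.
  by exists k.*2.+1 => //; rewrite /W/= odd_double/= uphalf_double.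
have W0 k : 0 <= diam_pow s (W k) by exact: diam_pow_ge0.
apply: lime_le; first by apply: is_cvg_nneseries => k _ _.
apply: nearW => N.
apply: (@le_trans _ _ (\sum_(0 <= k < N.*2) diam_pow s (W k))).
  apply: lee_sum_nneg_natr => //; rewrite -addnn leq_addr//.
have -> : \sum_(0 <= k < N.*2) diam_pow s (W k) =
    \sum_(0 <= k < N) diam_pow s (U k) + \sum_(0 <= k < N) diam_pow s (V k).
  elim: N => [|N IH]; first by rewrite !big_geq// adde0.
  rewrite doubleS !big_nat_recr//= IH /W/= odd_double/= doubleK uphalf_double.
  by rewrite -addeA addeACA.
by apply: leeD; apply: nneseries_lim_ge => k _ _; exact: diam_pow_ge0.
Qed.

Lemma hausdorff_delta_seq (T : eqType) (l : seq T) (F : T -> set 'rV[R]_n)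
    (c : T -> R) s d E : (0 <= d)%R ->
  (forall x, E x -> exists2 i, i \in l & F i x) ->
  (forall i, i \in l -> hausdorff_delta s d (F i) <= (c i)%:E) ->
  hausdorff_delta s d E <= (\sum_(i <- l) c i)%:E.
Proof.
move=> d0; elim: l E => [|i l IH] E El Fc.
  rewrite big_nil (_ : E = set0) ?hausdorff_delta_set0//.
  by apply/seteqP; split => // x /El[].
rewrite big_cons EFinD.
apply: (@le_trans _ _ (hausdorff_delta s d (F i `|` (E `\` F i)))).
  by apply: hausdorff_delta_sub => x Ex; have [] := pselect (F i x); [left|right].
apply: le_trans (hausdorff_deltaU _ _ _ _) _; apply: leeD.
  by apply: Fc; rewrite mem_head.
apply: IH => [x [Ex Fix]|j jl]; last by apply: Fc; rewrite inE jl orbT.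
by have [j] := El _ Ex; rewrite inE => /orP[/eqP ->//|jl Fjx]; exists j.
Qed.

Lemma hausdorff_measure_seq (T : eqType) (l : seq T) (F : T -> set 'rV[R]_n)
    (c : T -> R) s E :
  (forall x, E x -> exists2 i, i \in l & F i x) ->
  (forall i, i \in l -> hausdorff_measure s (F i) <= (c i)%:E) ->
  hausdorff_measure s E <= (\sum_(i <- l) c i)%:E.
Proof.
move=> El Fc; apply: hausdorff_measure_le => d d0.
apply: (hausdorff_delta_seq (ltW d0) El) => i il.
exact: le_trans (hausdorff_delta_le _ _ d0) (Fc _ il).
Qed.

(** * Hausdorff measure under similarities *)

Section Similarity.
Variables (f : 'rV[R]_n -> 'rV[R]_n) (r : R).
Hypothesis r0 : (0 < r)%R.
Hypothesis f_sim : forall x y, edist (f x) (f y) = (r * edist x y)%R.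

Lemma diam_preimage U : r%:E * diam (f @^-1` U) <= diam U.
Proof.
rewrite muleC -lee_pdivlMr//; apply: diam_le => [|x y Ux Uy].
  by rewrite mule_ge0 ?diam_ge0// lee_fin invr_ge0 ltW.
rewrite lee_pdivlMr// -EFinM mulrC -f_sim; exact: le_diam.
Qed.

Lemma diam_pow_preimage s U : (0 <= s)%R ->
  (r `^ s)%:E * diam_pow s (f @^-1` U) <= diam_pow s U.
Proof.
move=> s0; have [[x Ux]|/set0P/negP/negPn/eqP ->] := pselect (f @^-1` U !=set0).
  rewrite !diam_pow_neq0; [|by exists (f x)|by exists x].
  rewrite -poweR_EFin -poweRM ?diam_ge0 ?lee_fin ?(ltW r0)//.
  by apply: le_poweR => //; [rewrite mule_ge0 ?diam_ge0 ?lee_fin ?(ltW r0)|exact: diam_preimage].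
by rewrite diam_pow_set0 mule0 diam_pow_ge0.
Qed.

(** Pulling a cover of the image back along [f] gives a cover of [E], and diameters grow by a factor
    of at most [r^-1]. *)
Lemma hausdorff_measure_image s E : (0 <= s)%R ->
  (r `^ s)%:E * hausdorff_measure s E <= hausdorff_measure s (f @` E).
Proof.
move=> s0; have rs0 : (0 < r `^ s)%R by rewrite powR_gt0.
rewrite muleC -lee_pdivlMr//; apply: hausdorff_measure_le => d d0.
have rd0 : (0 < r * d)%R by rewrite mulr_gt0.
rewrite lee_pdivlMr// muleC; apply: le_trans (hausdorff_delta_le _ _ rd0).
apply: le_ereal_inf_tmp => _ [U [EU Ud] <-].
apply: (@le_trans _ _ (\sum_(0 <= k <oo) (r `^ s)%:E * diam_pow s (f @^-1` U k))).
  rewrite nneseriesZl; last by move=> k _; exact: diam_pow_ge0.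
  rewrite lee_pmul2l//; apply: ereal_inf_lbound.
  exists (fun k => f @^-1` U k) => //; split.
    move=> x Ex; have [|k _ Uk] := EU (f x); first by exists x.
    by exists k.
  move=> k; have := le_trans (diam_preimage (U k)) (Ud k).
  by rewrite EFinM lee_pmul2l.
apply: lee_nneseries => k *; last exact: diam_pow_preimage.
by rewrite mule_ge0 ?diam_pow_ge0// lee_fin ltW.
Qed.

Lemma hausdorff_measure_image0 s E : (0 <= s)%R ->
  hausdorff_measure s (f @` E) = 0 -> hausdorff_measure s E = 0.
Proof.
move=> s0 fE0; have := hausdorff_measure_image E s0; rewrite fE0 => E0.
apply/eqP; rewrite eq_le hausdorff_measure_ge0 andbT.
by rewrite -(@lee_pmul2l _ (r `^ s)%:E) ?mule0// lte_fin powR_gt0.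
Qed.

End Similarity.

Lemma hausdorff_measure_gt_exponent s t E : (0 <= s)%R -> (s < t)%R ->
  hausdorff_measure s E = 0 -> hausdorff_measure t E = 0.
Proof.
move=> s0 st Es0; apply/eqP; rewrite eq_le hausdorff_measure_ge0 andbT.
apply: hausdorff_measure_le => d d0.
(* On sets of diameter at most 1, raising the exponent does not increase the power of the
   diameter. *)
pose e := Num.min d 1%R.
have e0 : (0 < e)%R by rewrite lt_min d0/=.
have de : (e <= d)%R by rewrite ge_min lexx.
apply: le_trans (hausdorff_delta_anti t E de) _.
rewrite -Es0; apply: le_trans (hausdorff_delta_le s E e0).
apply: le_ereal_inf_tmp => _ [U [EU Ue] <-].
apply: ge_ereal_inf; exists (\sum_(0 <= k <oo) diam_pow t (U k)); first by exists U.
apply: lee_nneseries => k *; first exact: diam_pow_ge0.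
have t0 : (0 < t)%R by exact: le_lt_trans st.
rewrite diam_powE//; have := Ue k; have := diam_ge0 (U k).
case Ukd : (diam (U k)) => [u| |]//=; rewrite !lee_fin => u0 ue.
have u1 : (u <= 1)%R by rewrite (le_trans ue)// ge_min lexx orbT.
move: u0; rewrite le_eqVlt => /orP[/eqP <-|u0].
  by rewrite powR0 ?gt_eqF// diam_pow_ge0.
rewrite diam_pow_neq0; first by rewrite Ukd poweR_EFin lee_fin ger_powR ?u0 ?u1// ltW.
apply/set0P/negP => /eqP Uk0; move: u0; rewrite -lte_fin -Ukd Uk0 ltNge.
by rewrite diam_le.
Qed.

(* Without such an exponent the infimum defining [hausdorff_dim] would be taken
   over the empty set, hence 0. *)
Definition has_null_exponent E := exists2 t, (0 <= t)%R & hausdorff_measure t E = 0.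

Lemma hausdorff_dim_ge0 E : has_null_exponent E -> (0 <= hausdorff_dim E)%R.
Proof. by move=> [t t0 Et0]; apply: lb_le_inf => [|u []//]; exists t. Qed.

Lemma hausdorff_measure_gt_dim t E : has_null_exponent E ->
  (hausdorff_dim E < t)%R -> hausdorff_measure t E = 0.
Proof.
move=> [u u0 Eu0] /inf_lt[|s [s0 Es0] st]; last exact: hausdorff_measure_gt_exponent Es0.
by exists u.
Qed.

End HausdorffMeasure.

(** * Words and the coding map *)

Lemma positive_lower_bound (R : realType) (T : eqType) (l : seq T) (p : T -> R) :
  (forall i, i \in l -> 0 < p i) ->
  exists m : R, [/\ 0 < m, m <= 1 & forall i, i \in l -> m <= p i].
Proof.
elim: l => [|i l IH] lp; first by exists 1.
have [|m [m0 m1 ml]] := IH; first by move=> j jl; apply: lp; rewrite inE jl orbT.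
exists (Num.min (p i) m); split; first by rewrite lt_min m0 lp ?mem_head.
  by rewrite ge_min m1 orbT.
move=> j; rewrite inE ge_min => /orP[/eqP ->|/ml ->]; last by rewrite orbT.
by rewrite lexx.
Qed.

(** Any two positions of [l], taken in order, are related by [B], so [P] holds at no more than one
    of them. In this way a small set is charged to only one of several separated copies. *)
Lemma sum_at_most_one (R : realType) (T : eqType) (l : seq T) (B : T -> T -> bool)
    (P : T -> bool) (e : R) :
  0 <= e -> pairwise B l ->
  (forall i j, i \in l -> j \in l -> B i j -> P i -> P j -> False) ->
  \sum_(i <- l) (if P i then e else 0) <= e.
Proof.
move=> e0; elim: l => [|i l IH]; first by rewrite big_nil.
rewrite pairwise_cons big_cons => /andP[/allP iB lB] BP.
have [Pi|nPi] := boolP (P i); last first.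
  rewrite add0r; apply: IH => // j k jl kl; apply: BP; by rewrite inE ?jl ?kl orbT.
rewrite big1_seq ?addr0// => j /andP[_ jl]; case: ifPn => // Pj.
by have [] := BP i j (mem_head _ _) _ (iB j jl) Pi Pj; rewrite inE jl orbT.
Qed.

Section Words.
Context {M : nat}.
Implicit Types (u v w : seq 'I_M) (alpha beta : nat -> 'I_M).

Definition cat_word w beta : nat -> 'I_M :=
  fun l => if (l < size w)%N then nth (beta 0%N) w l else beta (l - size w)%N.

Lemma cat_word0 beta : cat_word [::] beta = beta.
Proof. by apply/funext => l; rewrite /cat_word subn0. Qed.

Lemma cat_word_cat u v beta : cat_word (u ++ v) beta = cat_word u (cat_word v beta).
Proof.
apply/funext => l; rewrite /cat_word size_cat nth_cat.
case: (ltnP l (size u)) => lu; first by rewrite ltn_addr// (set_nth_default (beta 0%N)).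
have -> : (l - size u < size v)%N = (l < size u + size v)%N by lia.
by rewrite subnDA.
Qed.

Lemma cat_word_agree u v beta gamma l : (l < size u)%N ->
  cat_word (u ++ v) beta l = cat_word u gamma l.
Proof.
by move=> lu; rewrite cat_word_cat /cat_word lu; exact: set_nth_default.
Qed.

Lemma prefix_cat_word w beta k :
  prefix_word (cat_word w beta) (size w + k) = w ++ prefix_word beta k.
Proof.
apply: (@eq_from_nth _ (beta 0%N)) => [|l]; first by rewrite size_cat !size_mkseq.
rewrite size_mkseq => lk; rewrite nth_mkseq// /cat_word nth_cat; case: ltnP => // wl.
by rewrite nth_mkseq//; lia.
Qed.

Lemma prefix_cat_word_size w beta : prefix_word (cat_word w beta) (size w) = w.
Proof. by rewrite -[X in prefix_word _ X]addn0 prefix_cat_word cats0. Qed.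

Lemma cat_prefix_word alpha k :
  cat_word (prefix_word alpha k) (fun l => alpha (k + l)%N) = alpha.
Proof.
apply/funext => l; rewrite /cat_word size_mkseq; case: ltnP => lk.
  by rewrite nth_mkseq.
by rewrite subnKC.
Qed.

Lemma prefix_wordD alpha j k :
  prefix_word alpha (j + k) = prefix_word alpha j ++ prefix_word (fun l => alpha (j + l)%N) k.
Proof.
have := prefix_cat_word (prefix_word alpha j) (fun l => alpha (j + l)%N) k.
by rewrite cat_prefix_word size_mkseq.
Qed.

End Words.

Section CodingMap.
Context {R : realType} {n M : nat}.
Variables (S : 'I_M -> 'rV[R]_n -> 'rV[R]_n) (r : 'I_M -> R).
Hypothesis S_sim : forall i, contracting_similarity (r i) (S i).
Hypothesis S_cube : forall i, S i @` @unit_cube R n `<=` @unit_cube R n.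
Implicit Types (u v w : seq 'I_M) (alpha beta : nat -> 'I_M) (x y : 'rV[R]_n).

Definition ratio w : R := \prod_(i <- w) r i.

Lemma ratio_cat u v : ratio (u ++ v) = ratio u * ratio v.
Proof. exact: big_cat. Qed.

Lemma ratio_gt0 w : 0 < ratio w.
Proof. by apply: prodr_gt0 => i _; have [/andP[]] := S_sim i. Qed.

Lemma ratio_le1 w : ratio w <= 1.
Proof.
elim: w => [|i w IH]; first by rewrite /ratio big_nil.
have [/andP[r0 r1] _] := S_sim i.
by rewrite /ratio big_cons mulr_ile1// ltW// ratio_gt0.
Qed.

Lemma ratio_powR_cat u v (s : R) : ratio (u ++ v) `^ s = ratio u `^ s * ratio v `^ s.
Proof. by rewrite ratio_cat powRM// ltW// ratio_gt0. Qed.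

Lemma ratio_ge : exists2 m : R, 0 < m <= 1 & forall w, m ^+ size w <= ratio w.
Proof.
have [i _|m [m0 m1 mr]] := @positive_lower_bound R _ (enum 'I_M) r.
  by have [/andP[]] := S_sim i.
exists m; first by rewrite m0.
elim=> [|i w IH]; first by rewrite /ratio big_nil.
rewrite /ratio big_cons exprS ler_pM ?exprn_ge0 ?(ltW m0)//.
by apply: mr; rewrite mem_enum.
Qed.

Lemma ratio_le : exists2 m : R, 0 <= m < 1 & forall w, ratio w <= m ^+ size w.
Proof.
have [i _|m [m0 m1 mr]] := @positive_lower_bound R _ (enum 'I_M) (fun i => 1 - r i).
  by have [/andP[_ ?]] := S_sim i; rewrite subr_gt0.
exists (1 - m); first by rewrite subr_ge0 m1 ltrBlDr ltrDl.
elim=> [|i w IH]; first by rewrite /ratio big_nil.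
rewrite /ratio big_cons exprS ler_pM ?(ltW (ratio_gt0 _))//.
  by have [/andP[/ltW]] := S_sim i.
by rewrite lerBrDr addrC -lerBrDr; apply: mr; rewrite mem_enum.
Qed.

Lemma ratio_small (e : R) : 0 < e -> exists N, forall w, (N <= size w)%N -> ratio w < e.
Proof.
move=> e0; have [m /andP[m0 m1] mr] := ratio_le.
have mcvg : (m ^+ k @[k --> \oo] --> 0) by apply: cvg_expr; rewrite ger0_norm.
have /cvgrPdist_lt/(_ _ e0)[N _ Nm] := mcvg.
exists N => w Nw; apply: le_lt_trans (mr w) _.
by have := Nm _ Nw; rewrite sub0r normrN ger0_norm// exprn_ge0.
Qed.

Lemma word_map_cat u v x : word_map S (u ++ v) x = word_map S u (word_map S v x).
Proof. by elim: u => //= i u ->. Qed.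

Lemma edist_word_map w x y : edist (word_map S w x) (word_map S w y) = ratio w * edist x y.
Proof.
elim: w => [|i w IH] /=; first by rewrite /ratio big_nil mul1r.
by have [_ ->] := S_sim i; rewrite IH /ratio big_cons mulrA.
Qed.

Lemma word_map_cube w x : unit_cube x -> unit_cube (word_map S w x).
Proof. by elim: w => //= i w IH /IH cx; apply: S_cube; exists (word_map S w x). Qed.

Lemma edist_word_map_cube w x y : unit_cube x -> unit_cube y ->
  edist (word_map S w x) (word_map S w y) <= cube_bound (R := R) (n := n) * ratio w.
Proof.
move=> cx cy; rewrite edist_word_map mulrC ler_pM2r ?ratio_gt0//.
exact: edist_cube.
Qed.

Lemma word_map_continuous w : continuous (word_map S w).
Proof.
move=> x B /nbhs_ballP[e/= e0 eB].
(* Neighbourhoods refer to the sup norm, and [edist] is at most [Num.sqrt n%:R] times the sup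
   distance; the larger divisor [cube_bound] makes the final inequality strict. *)
pose d := e / cube_bound (R := R) (n := n).
have D0 : 0 < cube_bound (R := R) (n := n) by exact: lt_le_trans cube_bound_ge1.
have d0 : 0 < d by rewrite divr_gt0.
apply/nbhs_ballP; exists d => //= y [_ xdy]; apply: eB; split => // i j; rewrite (ord1 i) /ball/=.
apply: (le_lt_trans (le_coord_edist _ _ _)); rewrite edist_word_map.
have xy k : `|x 0 k - y 0 k| <= d.
  by have /ltW := xdy 0 k.
apply: (@le_lt_trans _ _ (Num.sqrt n%:R * d)).
  apply: le_trans (edist_le_norm (ltW d0) xy).
  by rewrite ler_piMl ?edist_ge0// ratio_le1.
by rewrite /d mulrCA gtr_pMr// ltr_pdivrMr// mul1r ltrDl.
Qed.

Lemma compact_unit_cube : compact (@unit_cube R n).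
Proof.
rewrite (_ : @unit_cube R n = [set v | forall i, `[0, 1]%classic (v ord0 i)]).
  by apply: (@rV_compact R n (fun=> `[0, 1]%classic)) => i; exact: segment_compact.
by apply/seteqP; split => x xc i; have := xc i; rewrite /= in_itv.
Qed.

Definition nested_cube alpha k : set 'rV[R]_n :=
  word_map S (prefix_word alpha k) @` @unit_cube R n.

Lemma closed_nested_cube alpha k : closed (nested_cube alpha k).
Proof.
apply: compact_closed; first exact: norm_hausdorff.
apply: continuous_compact compact_unit_cube.
by apply: continuous_subspaceT; exact: word_map_continuous.
Qed.

Lemma nested_cube_sub alpha j k : (j <= k)%N -> nested_cube alpha k `<=` nested_cube alpha j.
Proof.
move=> /subnKC <-; rewrite /nested_cube prefix_wordD => _ [x cx <-].
rewrite word_map_cat; eexists; last by [].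
exact: word_map_cube.
Qed.

(** By compactness the images of the origin have a cluster point, and it lies in every nested cube
    because these are closed and decreasing. *)
Lemma nested_cube_nonempty alpha : exists x, forall k, nested_cube alpha k x.
Proof.
pose o : 'rV[R]_n := 0; have co : unit_cube o by move=> i; rewrite mxE lexx ler01.
pose f k := word_map S (prefix_word alpha k) o.
have [|x [_ fx]] := @compact_unit_cube (f @ \oo) _.
  by exists 0%N => // k _; exact: word_map_cube.
exists x => k; apply: closed_nested_cube => B xB.
have [|y [[l yl] By]] := fx (nested_cube alpha k) B _ xB; last by exists y; split => //; exists l.
exists k => // j /= kj; apply: (nested_cube_sub kj).
by exists o.
Qed.

Lemma nested_cube_unique alpha x y :
  (forall k, (1 <= k)%N -> nested_cube alpha k x) ->
  (forall k, (1 <= k)%N -> nested_cube alpha k y) -> x = y.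
Proof.
move=> Kx Ky; apply: edist_eq0; apply/eqP; rewrite eq_le edist_ge0 andbT.
apply/ler_addgt0Pr => e e0; rewrite add0r.
have D0 : 0 < cube_bound (R := R) (n := n) by exact: lt_le_trans cube_bound_ge1.
have [N Nr] := ratio_small (divr_gt0 e0 D0).
have [u cu <-] := Kx N.+1 isT; have [v cv <-] := Ky N.+1 isT.
apply: le_trans (edist_word_map_cube _ cu cv) _.
by rewrite mulrC -ler_pdivlMr// ltW// Nr// size_mkseq.
Qed.

(** Existence and uniqueness make the intersection a singleton, so [get] returns its point. Level 0
    is not part of the intersection, but it contains level 1. *)
Lemma coding_map_nested alpha k : nested_cube alpha k (coding_map S alpha).
Proof.
have [x Kx] := nested_cube_nonempty alpha.
have : [set x | \bigcap_(k in [set k | (1 <= k)%N]) nested_cube alpha k = [set x]]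
    (coding_map S alpha).
  apply: getPex; exists x; apply/seteqP; split => [y Ky|_ -> j _]; last exact: Kx.
  exact: nested_cube_unique Ky (fun k _ => Kx k).
move=> /= Kc; case: k => [|k].
  apply: (@nested_cube_sub _ _ 1%N) => //.
  suff : (\bigcap_(k in [set k | (1 <= k)%N]) nested_cube alpha k) (coding_map S alpha) by exact.
  by rewrite Kc.
suff : (\bigcap_(k in [set k | (1 <= k)%N]) nested_cube alpha k) (coding_map S alpha) by exact.
by rewrite Kc.
Qed.

Lemma coding_map_cube alpha : unit_cube (coding_map S alpha).
Proof. by have [x cx <-] := coding_map_nested alpha 0. Qed.

Lemma coding_map_cat_word w beta :
  coding_map S (cat_word w beta) = word_map S w (coding_map S beta).
Proof.
apply: (@nested_cube_unique (cat_word w beta)) => k _; first exact: coding_map_nested.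
apply: (@nested_cube_sub _ _ (size w + k)%N); first exact: leq_addl.
rewrite /nested_cube prefix_cat_word; have [x cx <-] := coding_map_nested beta k.
by exists x => //; rewrite word_map_cat.
Qed.

Lemma edist_coding_map alpha k x : unit_cube x ->
  edist (coding_map S alpha) (word_map S (prefix_word alpha k) x) <=
  cube_bound (R := R) (n := n) * ratio (prefix_word alpha k).
Proof.
by move=> cx; have [y cy <-] := coding_map_nested alpha k; exact: edist_word_map_cube.
Qed.

End CodingMap.

(** * The subshift *)

Section Subshift.
Context {R : realType} {n M : nat}.
Variables (S : 'I_M -> 'rV[R]_n -> 'rV[R]_n) (r : 'I_M -> R) (A : 'M[nat]_M).
Hypothesis S_sim : forall i, contracting_similarity (r i) (S i).
Hypothesis S_cube : forall i, S i @` @unit_cube R n `<=` @unit_cube R n.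
Hypothesis A01 : forall i j, A i j = 0%N \/ A i j = 1%N.
Hypothesis A_irr : irreducible_mx A.
Implicit Types (u v w p : seq 'I_M) (alpha beta gamma : nat -> 'I_M).
Local Notation D := (cube_bound (R := R) (n := n)).

Definition subshift_from (a : 'I_M) : set (nat -> 'I_M) :=
  [set beta | subshift A beta /\ beta 0%N = a].

(** Stands for a path from [i] to [j] with the endpoint [j] omitted. Described by its action on
    sequences, it composes by concatenation. *)
Definition connects w i j :=
  forall beta, subshift_from j beta -> subshift_from i (cat_word w beta).

Lemma subshift_cat_prefix alpha gamma k : subshift A alpha ->
  subshift_from (alpha k) gamma -> subshift A (cat_word (prefix_word alpha k) gamma).
Proof.
move=> Aalpha [Agamma gamma0] l; rewrite /cat_word size_mkseq.
have [lk|kl] := ltnP l.+1 k; first by rewrite (ltnW lk) !nth_mkseq// ltnW.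
have [lk|lk] := ltnP l k; last by rewrite subSn.
have kE : k = l.+1 by apply/eqP; rewrite eqn_leq kl lk.
by rewrite nth_mkseq// kE subnn gamma0 kE.
Qed.

Lemma subshift_cons i beta : subshift A beta -> A i (beta 0%N) = 1%N ->
  subshift_from i (cat_word [:: i] beta).
Proof.
move=> Abeta Ai; split=> // -[|l] /=; first by rewrite /cat_word.
by rewrite /cat_word/= !subn1.
Qed.

Lemma connects_power m i j : (0 < (A ^+ m) i j)%N -> exists w, connects w i j.
Proof.
elim: m i => [|m IH] i.
  rewrite expr0 mxE; case: eqVneq => // -> _; exists [::] => beta.
  by rewrite cat_word0.
rewrite exprS mxE => Am.
have [k [Aik Akj]] : exists k, (0 < A i k)%N /\ (0 < (A ^+ m) k j)%N.
  apply: contrapT => /forallNP noK; move: Am; rewrite big1// => k _.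
  have [Aik|] := posnP (A i k); first by rewrite Aik mul0r.
  have [Akj _|] := posnP ((A ^+ m) k j); first by rewrite Akj mulr0.
  by move=> Akj Aik; case: (noK k).
have [w wkj] := IH _ Akj; exists (i :: w) => beta /wkj[Abeta beta0].
rewrite -cat1s cat_word_cat; apply: subshift_cons => //; rewrite beta0.
by case: (A01 i k) Aik => ->.
Qed.

Lemma bounded_connectors : exists L, forall i j,
  exists2 w, (size w <= L)%N & connects w i j.
Proof.
have /(_ _)/cid wP (ij : 'I_M * 'I_M) : exists w, connects w ij.1 ij.2.
  by have [m [_ /connects_power]] := A_irr ij.1 ij.2.
exists (\max_(ij : 'I_M * 'I_M) size (sval (wP ij))) => i j.
exists (sval (wP (i, j))); last exact: (svalP (wP (i, j))).
exact: (leq_bigmax (i, j)).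
Qed.

(** Cut [alpha] at the first length, at least [size w0], where the ratio is at most [d], then append
    a word leading back to [a]. The last letter kept and the appended word each cost only a bounded
    factor. *)
Lemma subshift_approx a w0 : exists2 c : R, 0 < c <= 1 &
  forall alpha (d : R), subshift A alpha -> cylinder w0 alpha -> 0 < d <= 1 ->
  exists p, [/\ c * d <= ratio r p <= d, (size w0 <= size p)%N,
    (forall beta, subshift_from a beta ->
       subshift A (cat_word p beta) /\ cylinder w0 (cat_word p beta)) &
    (forall x, unit_cube x ->
       edist (coding_map S alpha) (word_map S p x) <= D * d)].
Proof.
have [L conn] := bounded_connectors.
have [m /andP[m0 m1] mr] := ratio_ge S_sim.
have mX k : 0 < m ^+ k by rewrite exprn_gt0.
have mX1 k : m ^+ k <= 1 by exact: exprn_ile1 (ltW m0) m1.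
(* [m ^+ L] pays for the connecting word. The other factor pays for the last letter of the prefix
   or, if the prefix is [w0] itself, for all of [w0]. *)
exists (m ^+ (size w0).+1 * m ^+ L).
  by rewrite mulr_gt0//= mulr_ile1// ltW.
move=> alpha d Aalpha w0alpha /andP[d0 d1].
have exk : exists k, (size w0 <= k)%N && (ratio r (prefix_word alpha k) <= d).
  have [N Nr] := ratio_small S_sim d0.
  exists (maxn N (size w0)); rewrite leq_maxr/= ltW// Nr// size_mkseq.
  exact: leq_maxl.
case: (ex_minnP exk) => k /andP[w0k kd] kmin.
have [u uL ua] := conn (alpha k) a.
exists (prefix_word alpha k ++ u); split.
- rewrite ratio_cat; apply/andP; split; last first.
    by apply: le_trans kd; rewrite ler_piMr ?(ratio_le1 S_sim) ?(ltW (ratio_gt0 S_sim _)).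
  rewrite mulrAC ler_pM ?mulr_ge0 ?(ltW (mX _)) ?(ltW d0)//; last first.
    by apply: le_trans (mr u); rewrite ler_wiXn2l// ltW.
  move: w0k; rewrite leq_eqVlt => /orP[/eqP <-|].
    rewrite w0alpha; apply: le_trans (mr w0).
    by rewrite exprS mulrAC ler_piMl ?(ltW (mX _))// mulr_ile1// ltW.
  case: k kd kmin {ua} => // k kd kmin; rewrite ltnS => w0k.
  have dk : d < ratio r (prefix_word alpha k).
    by rewrite ltNge; apply/negP => dk; have := kmin k; rewrite w0k dk ltnn => /(_ isT).
  rewrite -[k.+1]addn1 prefix_wordD ratio_cat.
  apply: (@le_trans _ _ (d * m)).
    by rewrite exprS mulrC ler_pM2l// ler_piMr// ltW.
  rewrite ler_pM ?(ltW d0) ?(ltW m0) ?(ltW dk)//.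
  by have := mr (prefix_word (fun l => alpha (k + l)%N) 1); rewrite size_mkseq.
- by rewrite size_cat size_mkseq (leq_trans w0k)// leq_addr.
- move=> beta /ua[Abeta beta0]; rewrite cat_word_cat; split.
    exact: subshift_cat_prefix.
  rewrite /cylinder/= -[RHS]w0alpha.
  have -> : k = (size w0 + (k - size w0))%N by rewrite subnKC.
  by rewrite prefix_wordD cat_word_cat w0alpha prefix_cat_word_size.
- move=> x cx; rewrite word_map_cat.
  have cux := word_map_cube S_cube u cx.
  apply: le_trans (edist_coding_map S_sim S_cube alpha k cux) _.
  by rewrite ler_pM2l// (lt_le_trans _ cube_bound_ge1).
Qed.

Definition limit_set_from a : set 'rV[R]_n := coding_map S @` subshift_from a.

Lemma limit_set_from_cube a : limit_set_from a `<=` @unit_cube R n.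
Proof. by move=> _ [alpha _ <-]; exact: coding_map_cube. Qed.

(** Nonemptiness makes concatenations of loops grow in length, so that the copies shrink. *)
Definition loop a w := w != [::] /\ connects w a a.

Lemma loop_cat a u v : loop a u -> loop a v -> loop a (u ++ v).
Proof.
move=> [u0 ua] [_ va]; split; first by case: u u0 {ua}.
by move=> beta /va/ua; rewrite cat_word_cat.
Qed.

Lemma loop_limit_set a w x : loop a w -> limit_set_from a x ->
  limit_set_from a (word_map S w x).
Proof.
move=> [_ wa] [beta /wa abeta <-]; exists (cat_word w beta) => //.
exact: coding_map_cat_word.
Qed.

Definition piece_gap a g u v := forall x y,
  limit_set_from a x -> limit_set_from a y ->
  g <= edist (word_map S u x) (word_map S v y).

(** For [g > 0] and a nonempty limit set this also forbids repetitions in [W]. *)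
Definition gapped_by a g W := pairwise (fun u v => `[< piece_gap a g u v >]) W.

End Subshift.

(** * The packing inequality *)

Section Packing.
Context {R : realType} {n M : nat}.
Variables (S : 'I_M -> 'rV[R]_n -> 'rV[R]_n) (r : 'I_M -> R) (A : 'M[nat]_M).
Hypothesis S_sim : forall i, contracting_similarity (r i) (S i).
Hypothesis S_cube : forall i, S i @` @unit_cube R n `<=` @unit_cube R n.
Variable a : 'I_M.
Implicit Types (u v w p : seq 'I_M) (W : seq (seq 'I_M)) (x y : 'rV[R]_n).
Local Notation D := (cube_bound (R := R) (n := n)).
Local Notation G := (limit_set_from S A a).

(** The point is coded by the infinite concatenation of the loops; each admissibility condition is
    checked on a long enough finite concatenation, completed by [beta]. *)
Lemma loop_chain_limit (q : nat -> seq 'I_M) : G !=set0 ->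
  (forall m, loop A a (q m)) ->
  exists2 x, G x & forall m y, unit_cube y ->
    edist x (word_map S (flatten (mkseq q m)) y) <= D * ratio r (flatten (mkseq q m)).
Proof.
move=> [_ [beta abeta _]] qa; pose p m := flatten (mkseq q m).
have pS m : p m.+1 = p m ++ q m by rewrite /p /mkseq -[m.+1]addn1 iotaD map_cat flatten_cat/= cats0.
have pD m k : exists v, p (m + k)%N = p m ++ v.
  elim: k => [|k [v IH]]; first by exists [::]; rewrite addn0 cats0.
  by exists (v ++ q (m + k)%N); rewrite addnS pS IH catA.
have p_size m : (m <= size (p m))%N.
  elim: m => // m IH; rewrite pS size_cat -addn1 leq_add// lt0n size_eq0.
  by have [] := qa m.
have p_conn m : connects A (p m) a a.
  elim: m => [|m IH] gamma agamma; first by rewrite cat_word0.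
  by rewrite pS cat_word_cat; apply: IH; have [_ qm] := qa m; exact: qm.
(* [p l.+1] has more than [l] letters, so this letter belongs to the concatenation and not to
   [beta]. *)
pose alpha l := cat_word (p l.+1) beta l.
have alphaE m l : (l < size (p m))%N -> alpha l = cat_word (p m) beta l.
  move=> lm; rewrite /alpha; have [lm'|ml] := leqP l.+1 m.
    have [v] := pD l.+1 (m - l.+1)%N; rewrite subnKC// => ->.
    by apply/esym/cat_word_agree/p_size.
  have [v] := pD m (l.+1 - m)%N; rewrite subnKC ?(ltnW ml)// => ->.
  exact: cat_word_agree.
have alpha_prefix m : prefix_word alpha (size (p m)) = p m.
  rewrite -[RHS](prefix_cat_word_size (p m) beta) /prefix_word.
  apply: (@eq_from_nth _ a) => [|l]; rewrite !size_mkseq// => lm.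
  by rewrite !nth_mkseq// (alphaE m).
have alpha_from : subshift_from A a alpha.
  split=> [l|]; last by rewrite (alphaE 1%N) ?p_size//; have [] := p_conn 1%N beta abeta.
  have l2 := p_size l.+2.
  rewrite (alphaE l.+2)// ?(alphaE l.+2 l) ?(ltnW l2)//.
  by have [Ap _] := p_conn l.+2 beta abeta; exact: Ap.
exists (coding_map S alpha); first by exists alpha.
move=> m y cy; have := edist_coding_map S_sim S_cube alpha (size (p m)) cy.
by rewrite alpha_prefix.
Qed.

(** * Cheap covers inherited by smaller copies *)

Section Branching.
Variables (W : seq (seq 'I_M)) (g t c : R) (V : nat -> set 'rV[R]_n) (e : nat -> R).
Hypothesis W_loop : forall w, w \in W -> loop A a w.
Hypothesis W_gap : gapped_by S A a g W.
Hypothesis W_size : (1 < size W)%N.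
Hypothesis W_sum : 1 <= \sum_(w <- W) ratio r w `^ t.
Hypothesis G_nonempty : G !=set0.
Hypothesis g_gt0 : 0 < g.
Hypothesis t_gt0 : 0 < t.
Hypothesis c_ge0 : 0 <= c.
Hypothesis c_lt : c < g `^ t.
Hypothesis e_ge0 : forall k, 0 <= e k.
Hypothesis V_diam : forall k x y, V k x -> V k y -> edist x y <= e k.

Definition meets k p := `[< exists2 x, G x & V k (word_map S p x) >].

Definition branch_cost p : \bar R :=
  \sum_(0 <= k <oo) (if meets k p then e k `^ t else 0)%:E.

(** One term is at most the whole cost, and [c < g ^ t] turns this into a bound on [e k] by the gap
    between the copies of [G] inside copy [p]. *)
Lemma meets_le p k : (branch_cost p <= (c * ratio r p `^ t)%:E)%E ->
  meets k p -> e k < g * ratio r p.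
Proof.
move=> pc kp; have rp0 := ratio_gt0 S_sim p.
have ec : e k `^ t <= c * ratio r p `^ t.
  rewrite -lee_fin; apply: le_trans pc.
  rewrite /branch_cost (nneseriesD1 (n := k))//=; last first.
    by move=> j _; case: ifP => _; rewrite lee_fin ?powR_ge0.
  rewrite kp leeDl// nneseries_ge0// => j _ _.
  by case: ifP => _; rewrite lee_fin ?powR_ge0.
rewrite ltNge; apply/negP => gk.
have : (g * ratio r p) `^ t <= e k `^ t.
  by apply: ge0_ler_powR; rewrite ?nnegrE ?(ltW t_gt0)// mulr_ge0// ltW.
rewrite powRM ?(ltW g_gt0) ?(ltW rp0)// => /le_trans/(_ ec).
by rewrite ler_pM2r ?powR_gt0// leNgt c_lt.
Qed.

(** By [meets_le], each [V k] is charged to at most one [p ++ w], so the costs of the subcopies add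
    up to at most that of [p]. Their allowances add up to at least that of [p], since [W_sum] holds;
    hence some subcopy stays within its own. *)
Lemma branch_step p : (branch_cost p <= (c * ratio r p `^ t)%:E)%E ->
  exists2 w, w \in W & (branch_cost (p ++ w) <= (c * ratio r (p ++ w) `^ t)%:E)%E.
Proof.
move=> pc; apply: contrapT => noW.
have {noW} lt_cost w : w \in W ->
    ((c * ratio r (p ++ w) `^ t)%:E < branch_cost (p ++ w))%E.
  by move=> wW; rewrite ltNge; apply/negP => wc; apply: noW; exists w.
have term_ge0 k q : (0 <= (if meets k q then e k `^ t else 0)%:E)%E.
  by case: ifP => _; rewrite lee_fin ?powR_ge0.
have sum_cost : (\sum_(w <- W) branch_cost (p ++ w) <= branch_cost p)%E.
  rewrite /branch_cost -nneseries_sum; last by move=> *; exact: term_ge0.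
  apply: lee_nneseries => k *; first by apply: sume_ge0 => w _; exact: term_ge0.
  rewrite sumEFin lee_fin.
  have [kp|kp] := boolP (meets k p); last first.
    rewrite big1_seq// => w /andP[_ wW]; case: ifP => // /asboolP[x Gx Vx].
    case/negP: kp; apply/asboolP; exists (word_map S w x); last by rewrite -word_map_cat.
    exact: loop_limit_set (W_loop wW) Gx.
  apply: (@sum_at_most_one _ _ _ (fun u v => `[< piece_gap S A a g u v >])
    (fun w => meets k (p ++ w))) => //.
    exact: powR_ge0.
  move=> u v _ _ /asboolP uv /asboolP[x Gx Vx] /asboolP[y Gy Vy].
  have := V_diam Vx Vy; rewrite !word_map_cat (edist_word_map S_sim).
  rewrite leNgt => /negP; apply; apply: lt_le_trans (meets_le pc kp) _.
  by rewrite [leRHS]mulrC ler_pM2r ?(ratio_gt0 S_sim)//; exact: uv.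
have : (\sum_(w <- W) (c * ratio r (p ++ w) `^ t)%:E < \sum_(w <- W) branch_cost (p ++ w))%E.
  have : W != [::] by case: W W_size.
  elim: W lt_cost => // w W' IH lt_cost _; rewrite !big_cons.
  have [->|W'0] := eqVneq W' [::]; first by rewrite !big_nil !adde0 lt_cost ?mem_head.
  apply: lteD; first by rewrite lt_cost ?mem_head.
  by apply: IH => // v vW; apply: lt_cost; rewrite inE vW orbT.
apply/negP; rewrite -leNgt; apply: (le_trans sum_cost); apply: (le_trans pc).
rewrite sumEFin lee_fin.
under eq_bigr do rewrite (ratio_powR_cat S_sim) mulrA.
by rewrite -mulr_sumr ler_peMr// mulr_ge0 ?powR_ge0.
Qed.

(** Following cheap copies forever leads to a point of some [U k]. The margin [tau k] lets [V k]
    contain an entire cheap copy, which is too large for [meets_le]. *)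
Lemma no_cheap_cover (U : nat -> set 'rV[R]_n) (tau : nat -> R) :
  (forall k, 0 < tau k) -> G `<=` \bigcup_k U k ->
  (forall k x y, U k x -> edist x y <= tau k -> V k y) ->
  (\sum_(0 <= k <oo) (e k `^ t)%:E <= c%:E)%E -> False.
Proof.
move=> tau0 GU UV ec.
pose good p := (branch_cost p <= (c * ratio r p `^ t)%:E)%E.
have good0 : good [::].
  rewrite /good /ratio big_nil powR1 mulr1; apply: le_trans ec.
  by apply: lee_nneseries => k *; case: ifP => _; rewrite lee_fin ?powR_ge0.
(* The choice function must be total, so any element of [W] will do where [p] is not good. *)
have /choice[f fP] p : exists w, w \in W /\ (good p -> good (p ++ w)).
  have [pgood|pbad] := pselect (good p).
    by have [w wW pw] := branch_step pgood; exists w.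
  by case: W W_size => // w W' _; exists w; rewrite mem_head.
pose p m := iter m (fun q => q ++ f q) [::].
have pE m : p m = flatten (mkseq (fun l => f (p l)) m).
  elim: m => // m IH; rewrite /mkseq -[m.+1]addn1 iotaD map_cat flatten_cat/= cats0.
  by rewrite -[flatten _]IH addn1.
have p_good m : good (p m) by elim: m => //= m IH; exact: (fP _).2.
have [x Gx xp] := loop_chain_limit G_nonempty (fun l => W_loop (fP (p l)).1).
have [k _ Ux] := GU x Gx.
have D0 : 0 < D by exact: lt_le_trans cube_bound_ge1.
have p_size m : (m <= size (p m))%N.
  elim: m => // m IH; rewrite /= size_cat -addn1 leq_add// lt0n size_eq0.
  by have [] := W_loop (fP (p m)).1.
have [N Nr] := ratio_small S_sim (divr_gt0 (tau0 k) D0).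
have Vp y : G y -> V k (word_map S (p N) y).
  move=> Gy; apply: UV Ux _; have cy := limit_set_from_cube S_sim S_cube Gy.
  have := xp N y cy; rewrite -pE => /le_trans; apply.
  by rewrite mulrC -ler_pdivlMr// ltW// Nr.
have [y Gy] := G_nonempty.
have kp : meets k (p N) by apply/asboolP; exists y => //; exact: Vp.
have := meets_le (p_good N) kp; rewrite ltNge => /negP; apply.
(* Two separated copies inside copy [p N] both lie in [V k], which forces [e k] to be at least the
   scaled gap. *)
case: W W_size W_gap W_loop => // u [//|v W'] _ /= /andP[/andP[/asboolP uv _] _] Wl.
have Gu : G (word_map S u y) by apply: loop_limit_set Gy => //; apply: Wl; rewrite mem_head.
have Gv : G (word_map S v y).
  by apply: loop_limit_set Gy => //; apply: Wl; rewrite !inE eqxx orbT.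
apply: le_trans (V_diam (Vp _ Gu) (Vp _ Gv)).
by rewrite (edist_word_map S_sim) mulrC ler_pM2l ?(ratio_gt0 S_sim)//; exact: uv.
Qed.

End Branching.

Lemma packing_positive (W : seq (seq 'I_M)) (g t : R) :
  (forall w, w \in W -> loop A a w) -> 0 < g -> gapped_by S A a g W ->
  (1 < size W)%N -> 1 <= \sum_(w <- W) ratio r w `^ t -> G !=set0 -> 0 < t ->
  hausdorff_measure t G <> 0%E.
Proof.
move=> Wl g0 Wg Ws Wsum G0 t0 Gt0.
have t_neq0 : t != 0 by rewrite gt_eqF.
have gt0 : 0 < g `^ t / 4 by rewrite divr_gt0 ?powR_gt0.
have : (hausdorff_delta t 1 G < (g `^ t / 4)%:E)%E.
  by apply: le_lt_trans (hausdorff_delta_le t G ltr01) _; rewrite Gt0 lte_fin.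
move=> /ereal_inf_lt[_ [U [GU U1] <-] Ucost].
pose d k := fine (diam (U k)).
have dE k : diam (U k) = (d k)%:E.
  rewrite /d fineK// ge0_fin_numE ?diam_ge0//.
  by apply: le_lt_trans (U1 k) _; rewrite ltry.
have d0 k : 0 <= d k by rewrite -lee_fin -dE diam_ge0.
(* Half of the budget [g ^ t / 2] is spent on the cover [U]; the other half is spread geometrically
   to enlarge every diameter strictly, even a zero one. *)
pose h k : R := g `^ t / 4 / (2 ^ k.+1)%:R.
have h0 k : 0 < h k by rewrite divr_gt0// ltr0n expn_gt0.
pose e k := (d k `^ t + h k) `^ (t^-1).
have eE k : e k `^ t = d k `^ t + h k.
  by rewrite /e -powRrM mulVf// powRr1// addr_ge0 ?powR_ge0// ltW.
have de k : d k < e k.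
  rewrite ltNge; apply/negP => ed.
  have : e k `^ t <= d k `^ t by apply: ge0_ler_powR; rewrite ?nnegrE ?powR_ge0// ltW.
  by rewrite eE gerDl leNgt h0.
(* Enlarging [U k] by this margin on both sides brings its diameter to at most [e k]. *)
pose tau k := (e k - d k) / 2.
(* The [V k] play the role of open sets covering [G]: no compactness is needed,
   only that a small enough copy of [G] near a point of [U k] lies in [V k]. *)
pose V k := [set y | exists2 x, U k x & edist x y <= tau k].
apply: (@no_cheap_cover W g t (g `^ t / 2) V e _ _ _ _ _ _ _ _ _ _ _ U tau) => //.
- by rewrite divr_ge0 ?powR_ge0.
- by rewrite ltr_pdivrMr// ltr_pMr ?powR_gt0// ltr1n.
- by move=> k; exact: powR_ge0.
- move=> k x y [x' Ux' xx'] [y' Uy' yy'].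
  have xy' : edist x' y' <= d k by rewrite -lee_fin -dE; exact: le_diam.
  have := edist_triangle x' x y; have := edist_triangle y' x' y.
  rewrite (edist_sym x x') => ? ?; rewrite /tau in xx' yy'; lra.
- by move=> k; rewrite divr_gt0// subr_gt0.
- by move=> k x y Ux xy; exists x.
- under eq_eseriesr do rewrite eE EFinD.
  apply: le_trans (epsilon_trick _ _ (ltW gt0)) _ => [k|]; first by rewrite lee_fin powR_ge0.
  have -> : g `^ t / 2 = g `^ t / 4 + g `^ t / 4 by field.
  rewrite EFinD leeD2r// (le_trans _ (ltW Ucost))//.
  apply: lee_nneseries => k *; first by rewrite lee_fin powR_ge0.
  by rewrite diam_powE// dE.
Qed.

(** A sum above 1 stays at least 1 for a slightly larger exponent, at which [packing_positive]
    contradicts the vanishing of the measure. *)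
Lemma packing_sum (W : seq (seq 'I_M)) (g s : R) : 0 <= s ->
  (forall t, s < t -> hausdorff_measure t G = 0%E) -> G !=set0 ->
  (forall w, w \in W -> loop A a w) -> 0 < g -> gapped_by S A a g W ->
  \sum_(w <- W) ratio r w `^ s <= 1.
Proof.
move=> s0 Gt G0 Wl g0 Wg; rewrite leNgt; apply/negP => sum1.
have rs1 w : ratio r w `^ s <= 1.
  by rewrite -(powRr0 (ratio r w)) ger_powR// (ratio_gt0 S_sim) (ratio_le1 S_sim).
have Ws : (1 < size W)%N.
  case: W sum1 {Wl Wg} => [|u [|v W']]//.
    by rewrite big_nil ltNge ler01.
  by rewrite big_seq1 ltNge rs1.
set sigma := \sum_(w <- W) _ in sum1.
have [w _|q [q0 q1 qW]] := @positive_lower_bound R _ W (ratio r); first exact: ratio_gt0 S_sim w.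
(* All ratios in [W] are at least [q], so raising the exponent by [ep] costs at most the factor
   [q ^ ep], which must be at least [sigma^-1]. The denominator [1 - ln q] is positive even for
   [q = 1]. *)
pose ep := ln sigma / (1 - ln q).
have lnq : ln q <= 0 by rewrite -ln1 ler_ln ?posrE.
have ln1q : 0 < 1 - ln q by rewrite subr_gt0 (le_lt_trans lnq).
have lnsigma : 0 < ln sigma by exact: ln_gt0.
have ep0 : 0 < ep by rewrite divr_gt0.
have sigma0 : 0 < sigma by exact: lt_trans sum1.
have qep : sigma^-1 <= q `^ ep.
  have epE : ep * (1 - ln q) = ln sigma by rewrite divfK ?gt_eqF.
  rewrite -[X in X^-1](@lnK _ sigma) ?posrE// -expRN /powR gt_eqF// ler_expR -epE.
  by rewrite mulrBr mulr1 opprB gerDl oppr_le0 ltW.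
apply: (@packing_positive W g (s + ep)) => //.
- apply: (@le_trans _ _ (\sum_(w <- W) ratio r w `^ s * q `^ ep)).
    by rewrite -mulr_suml -/sigma -ler_pdivrMl// mulr1.
  rewrite big_seq [leRHS]big_seq; apply: ler_sum => w wW.
  rewrite powRD; last by rewrite [X in _ ==> ~~ X]gt_eqF ?implybT// (ratio_gt0 S_sim).
  rewrite ler_wpM2l ?powR_ge0//; apply: ge0_ler_powR; rewrite ?nnegrE ?(ltW ep0) ?(ltW q0)//.
    by rewrite ltW// (ratio_gt0 S_sim).
  exact: qW.
- by rewrite ltr_wpDl.
- by apply: Gt; rewrite ltrDl.
Qed.
End Packing.

(** * Upper regularity *)

Section UpperRegularity.
Context {R : realType} {n M : nat}.
Variables (S : 'I_M -> 'rV[R]_n -> 'rV[R]_n) (r : 'I_M -> R) (A : 'M[nat]_M).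
Hypothesis S_sim : forall i, contracting_similarity (r i) (S i).
Hypothesis S_cube : forall i, S i @` @unit_cube R n `<=` @unit_cube R n.
Hypothesis A01 : forall i j, A i j = 0%N \/ A i j = 1%N.
Hypothesis A_irr : irreducible_mx A.
Variable a : 'I_M.
Implicit Types (u v w p : seq 'I_M) (W V P : seq (seq 'I_M)) (x y : 'rV[R]_n).
Local Notation D := (cube_bound (R := R) (n := n)).
Local Notation G := (limit_set_from S A a).

Let D_gt0 : 0 < D.
Proof. exact: lt_le_trans cube_bound_ge1. Qed.

Definition gapped W := exists2 g : R, 0 < g & gapped_by S A a g W.

Lemma gapped_by_le (g g' : R) W : g' <= g -> gapped_by S A a g W -> gapped_by S A a g' W.
Proof.
move=> gg'; apply: sub_pairwise => u v /asboolP uv; apply/asboolP => x y Gx Gy.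
exact: le_trans gg' (uv _ _ Gx Gy).
Qed.

Lemma gapped_cat W W' : gapped W -> gapped W' ->
  (exists2 g : R, 0 < g & forall u v, u \in W -> v \in W' -> piece_gap S A a g u v) ->
  gapped (W ++ W').
Proof.
move=> [g1 g1_gt0 W1] [g2 g2_gt0 W2] [g3 g3_gt0 W3].
have le1 : Num.min g1 (Num.min g2 g3) <= g1 by rewrite ge_min lexx.
have le2 : Num.min g1 (Num.min g2 g3) <= g2 by rewrite !ge_min lexx orbT.
have le3 : Num.min g1 (Num.min g2 g3) <= g3 by rewrite !ge_min lexx !orbT.
exists (Num.min g1 (Num.min g2 g3)); first by rewrite !lt_min g1_gt0 g2_gt0.
rewrite /gapped_by pairwise_cat; apply/and3P; split.
- apply/allrelP => u v uW vW; apply/asboolP => x y Gx Gy.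
  exact: le_trans le3 (W3 _ _ uW vW _ _ Gx Gy).
- exact: gapped_by_le W1.
- exact: gapped_by_le W2.
Qed.

Lemma gapped_map w W : gapped W -> gapped [seq w ++ v | v <- W].
Proof.
move=> [g g0 Wg]; have rw0 := ratio_gt0 S_sim w.
exists (ratio r w * g); first by rewrite mulr_gt0.
rewrite /gapped_by pairwise_map; apply: sub_pairwise Wg => u v /asboolP uv.
apply/asboolP => x y Gx Gy; rewrite !word_map_cat (edist_word_map S_sim).
by rewrite ler_pM2l// uv.
Qed.

(** Pairs with the same first word are separated by the rescaled gap of [V]. Otherwise the gap of
    [W] applies, because the loops [v] map [G] into itself. *)
Lemma gapped_allpairs W V : (forall v, v \in V -> loop A a v) ->
  gapped W -> gapped V -> gapped [seq w ++ v | w <- W, v <- V].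
Proof.
move=> Vl [g g0 Wg] gV; elim: W Wg => [|w W IH] /=; first by exists 1.
move=> /andP[/allP wW Wg]; apply: gapped_cat; [exact: gapped_map|exact: IH|].
exists g => // _ _ /mapP[v vV ->] /allpairsP[[w' v']/= [w'W v'V ->]] x y Gx Gy.
rewrite !word_map_cat; have /asboolP ww' := wW _ w'W.
by apply: ww'; apply: loop_limit_set => //; exact: Vl.
Qed.

(** * Packings and covers at the critical exponent *)

Section Exponent.
Variable s : R.
Hypothesis s_ge0 : 0 <= s.
Hypothesis null_above : forall t, s < t -> hausdorff_measure t G = 0%E.
Hypothesis G_nonempty : G !=set0.

Local Notation weight W := (\sum_(w <- W) ratio r w `^ s).

Definition packing_bound (C : R) := forall (E : set 'rV[R]_n) (eta : R),
  E `<=` G -> 0 < eta ->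
  exists W, [/\ (forall w, w \in W -> loop A a w), gapped W,
    (forall w, w \in W -> exists2 y, E y & forall z, G z -> edist y (word_map S w z) <= eta) &
    (hausdorff_delta s eta E <= (C * weight W)%:E)%E].

(** Take a separated family, of maximal length, of loops of ratio comparable to [d] with copies near
    [E]; [packing_sum] bounds the length. By maximality, neighbourhoods of the copies cover [E],
    each at a cost comparable to [ratio r w ^ s]. *)
Lemma greedy_packing : exists2 C : R, 0 < C & packing_bound C.
Proof.
have [c /andP[c0 c1] approx] := subshift_approx S_sim S_cube A01 A_irr a [:: a].
exists ((6 * D / c) `^ s); first by rewrite powR_gt0// divr_gt0// mulr_gt0.
(* Points within [2 * D * d] of a copy of diameter at most [D * d] form a set of diameter at most
   [6 * D * d], hence at most [eta]. *)
move=> E eta EG eta0; pose d := Num.min 1 (eta / (6 * D)).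
have D6 : 0 < 6 * D by rewrite mulr_gt0.
have d0 : 0 < d by rewrite lt_min ltr01 divr_gt0.
have d1 : d <= 1 by rewrite ge_min lexx.
have deta : 6 * D * d <= eta by rewrite mulrC -ler_pdivlMr// ge_min lexx orbT.
pose packing W := [/\ forall w, w \in W -> loop A a w,
  forall w, w \in W -> c * d <= ratio r w <= d,
  forall w, w \in W -> exists2 y, E y & forall z, G z -> edist y (word_map S w z) <= D * d &
  gapped_by S A a (D * d) W].
have Dd0 : 0 < D * d by rewrite mulr_gt0.
have cd0 : 0 < (c * d) `^ s by rewrite powR_gt0// mulr_gt0.
have packing_size W : packing W -> (size W)%:R <= ((c * d) `^ s)^-1.
  move=> [Wl Wr _ Wg].
  rewrite -[leRHS]mul1r ler_pdivlMr// mulrC.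
  apply: le_trans (packing_sum S_sim S_cube s_ge0 null_above G_nonempty Wl Dd0 Wg).
  rewrite -sum1_size natr_sum mulr_sumr big_seq [leRHS]big_seq; apply: ler_sum => w wW.
  rewrite mulr1; apply: ge0_ler_powR; rewrite ?nnegrE ?(ltW (ratio_gt0 S_sim _))//.
    by rewrite ltW// mulr_gt0.
  by have /andP[] := Wr _ wW.
pose P k := `[< exists2 W, size W = k & packing W >].
have exP : exists k, P k by exists 0%N; apply/asboolP; exists [::].
have [|k /asboolP[W Wk [Wl Wr WE Wg]] kmax] := @ex_maxnP P (Num.bound ((c * d) `^ s)^-1) exP.
  move=> k /asboolP[W <- /packing_size WN]; rewrite -(ler_nat R) (le_trans WN)//.
  by rewrite ltW// archi_boundP// invr_ge0 ltW.
exists W; split=> //; first by exists (D * d).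
  move=> w /WE[y Ey yw]; exists y => // z Gz; apply: le_trans (yw z Gz) _.
  by apply: le_trans deta; rewrite -mulrA ler_peMl// ?(ltW Dd0)// ler1n.
rewrite mulr_sumr.
pose F w := [set y | exists2 z, G z & edist y (word_map S w z) <= 2 * (D * d)].
apply: (@hausdorff_delta_seq _ _ _ W F) (ltW eta0) _ _ => [y Ey|w wW].
  apply: contrapT => noW.
  (* An uncovered point of [E] would provide one more loop [p] separated from the family. *)
  have [alpha [Aalpha alpha0] alphay] := EG _ Ey.
  have [||p [/andP[cp pd] p1 pa py]] := approx alpha d Aalpha.
  - by rewrite /cylinder/= /prefix_word /mkseq/= alpha0.
  - by rewrite d0.
  have pl : loop A a p.
    split; first by rewrite -size_eq0 -lt0n.
    move=> beta /pa[Abeta]; rewrite /cylinder/= /prefix_word /mkseq/= => -[beta0].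
    by split.
  have pE z : G z -> edist y (word_map S p z) <= D * d.
    by move=> Gz; rewrite -alphay; apply: py; exact: (limit_set_from_cube S_sim S_cube Gz).
  suff /kmax : P k.+1 by rewrite ltnn.
  apply/asboolP; exists (p :: W); first by rewrite /= Wk.
  split => [w|w|w|]; rewrite ?inE.
  - by move=> /orP[/eqP ->//|/Wl].
  - by move=> /orP[/eqP ->|/Wr//]; rewrite cp.
  - by move=> /orP[/eqP ->|/WE//]; exists y.
  rewrite /gapped_by/=; apply/andP; split; last exact: Wg.
  apply/allP => w wW; apply/asboolP => x z Gx Gz; rewrite leNgt; apply/negP => xz.
  apply: noW; exists w => //; exists z => //.
  apply: le_trans (edist_triangle (word_map S p x) _ _) _.
  by rewrite mulr_natl mulr2n lerD ?pE// ltW.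
have /andP[cw wd] := Wr _ wW.
apply: (@le_trans _ _ ((6 * D * d) `^ s)%:E).
  apply: hausdorff_delta_bounded => //; first exact: mulr_ge0 (ltW D6) (ltW d0).
  move=> y y' [z Gz yz] [z' Gz' yz'].
  have cz := limit_set_from_cube S_sim S_cube Gz.
  have cz' := limit_set_from_cube S_sim S_cube Gz'.
  have zz' : edist (word_map S w z) (word_map S w z') <= D * d.
    apply: le_trans (edist_word_map_cube S_sim w cz cz') _.
    by rewrite ler_pM2l.
  have := edist_triangle (word_map S w z) y y'.
  have := edist_triangle (word_map S w z') (word_map S w z) y'.
  rewrite edist_sym in yz'; lra.
rewrite lee_fin.
have -> : 6 * D * d = (6 * D / c) * (c * d) by field; rewrite gt_eqF.
have Dc0 : 0 <= 6 * D / c by rewrite ltW// divr_gt0.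
have cd0' : 0 <= c * d by rewrite ltW// mulr_gt0.
rewrite powRM//.
rewrite ler_wpM2l ?powR_ge0//; apply: ge0_ler_powR; rewrite ?nnegrE//.
exact: ltW (ratio_gt0 S_sim _).
Qed.

Lemma weight_allpairs P V : weight [seq p ++ v | p <- P, v <- V] = weight P * weight V.
Proof.
rewrite big_allpairs_dep mulr_suml; apply: eq_bigr => p _.
by rewrite mulr_sumr; apply: eq_bigr => v _; rewrite (ratio_powR_cat S_sim).
Qed.

Lemma gapped_weight_le1 W : (forall w, w \in W -> loop A a w) -> gapped W -> weight W <= 1.
Proof. by move=> Wl [g g0 Wg]; exact: packing_sum Wl g0 Wg. Qed.

(** Choose [P] of almost maximal weight with the words [p ++ v] separated. Balls around the images
    of [x] under [P] cost at most the stated bound. A packing [W] of the remainder can be added to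
    [P], so its weight is small and the remainder is cheap. *)
Lemma ball_exhaustion (C d rho : R) x V :
  packing_bound C -> 0 < C -> 0 < d -> 0 < rho -> 6 * rho <= d ->
  (forall v, v \in V -> loop A a v) -> gapped V ->
  (forall v, v \in V -> forall z, G z -> edist x (word_map S v z) <= 2 * rho) ->
  0 < weight V ->
  (hausdorff_delta s d G <= ((6 * rho) `^ s / weight V)%:E)%E.
Proof.
move=> greedy C0 d0 rho0 rhod Vl Vg Vx V0.
pose config P := (forall p, p \in P -> loop A a p) /\
  gapped [seq p ++ v | p <- P, v <- V].
have config_le P : config P -> weight P <= (weight V)^-1.
  move=> [Pl Pg]; rewrite -[leRHS]mul1r ler_pdivlMr// -weight_allpairs.
  apply: gapped_weight_le1 Pg => _ /allpairsP[[p v]/= [pP vV ->]].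
  by apply: loop_cat; [exact: Pl|exact: Vl].
pose T := [set weight P | P in config].
have T_sup : has_sup T.
  split; first by exists (weight [::]), [::] => //; split => //=; exists 1.
  by exists (weight V)^-1 => _ [P /config_le ? <-].
apply/lee_addgt0Pr => e e0.
have eC0 : 0 < e / C by rewrite divr_gt0.
have [_ [P [Pl Pg] <-] Psup] := sup_adherent eC0 T_sup.
have rp p : 0 < 3 * rho * ratio r p by rewrite !mulr_gt0// (ratio_gt0 S_sim).
(* The copies [p ++ v] lie within [2 * rho * ratio r p] of the image of [x]. Removing radius
   [3 * rho * ratio r p] leaves room at least [b], of which [eta] uses at most half. *)
pose E := G `&` [set y | forall p, p \in P -> 3 * rho * ratio r p < edist (word_map S p x) y].
have [p _|b [b0 _ bP]] := @positive_lower_bound R _ P (fun p => rho * ratio r p).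
  by rewrite mulr_gt0// (ratio_gt0 S_sim).
pose eta := Num.min (b / 2) d.
have eta0 : 0 < eta by rewrite lt_min divr_gt0.
have etab : eta <= b / 2 by rewrite ge_min lexx.
have etad : eta <= d by rewrite ge_min lexx orbT.
have [W [Wl Wg WE EW]] := greedy E eta (@subIsetl _ _ _) eta0.
have WP_config : config (W ++ P).
  split; first by move=> p; rewrite mem_cat => /orP[/Wl|/Pl].
  rewrite allpairs_cat; apply: gapped_cat => //; first exact: gapped_allpairs.
  exists (b / 2); first by rewrite divr_gt0.
  move=> _ _ /allpairsP[[w v]/= [wW vV ->]] /allpairsP[[p v']/= [pP v'V ->]] y z Gy Gz.
  rewrite !word_map_cat.
  have Gvy : G (word_map S v y) by apply: loop_limit_set Gy => //; exact: Vl.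
  have [e' [_ Ee'] we'] := WE _ wW.
  have far := Ee' _ pP; have near := we' _ Gvy.
  have near_p : edist (word_map S p x) (word_map S p (word_map S v' z)) <= 2 * (rho * ratio r p).
    by rewrite (edist_word_map S_sim) mulrA mulrC ler_pM2r ?(ratio_gt0 S_sim)//; exact: Vx.
  have t1 := edist_triangle (word_map S p (word_map S v' z)) (word_map S p x) e'.
  have t2 := edist_triangle (word_map S w (word_map S v y)) e' (word_map S p (word_map S v' z)).
  rewrite edist_sym in t2; have := bP _ pP; lra.
have W_small : weight W < e / C.
  have : weight (W ++ P) <= sup T by apply: ub_le_sup; [exact: T_sup.2|exists (W ++ P)].
  by rewrite big_cat/=; move: Psup; lra.
have G_cover : G `<=` E `|` (G `\` E).
  by move=> y Gy; have [|] := pselect (E y); [left|right].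
apply: le_trans (hausdorff_delta_sub s d G_cover) _.
apply: le_trans (hausdorff_deltaU s d _ _) _; rewrite addeC; apply: leeD.
  apply: (@le_trans _ _ (\sum_(p <- P) (6 * rho) `^ s * ratio r p `^ s)%:E).
    apply: (@hausdorff_delta_seq _ _ _ P
      (fun p => eball (word_map S p x) (3 * rho * ratio r p))) (ltW d0) _ _.
      move=> y [Gy Ey]; apply: contrapT => noP; apply: Ey; split=> // p pP.
      by rewrite ltNge; apply/negP => py; apply: noP; exists p.
    move=> p pP; have rp0 := ratio_gt0 S_sim p; have rp1 := ratio_le1 S_sim p.
    have rho6 : 0 <= 6 * rho by rewrite mulr_ge0// ltW.
    rewrite -powRM ?(ltW rp0)//; apply: hausdorff_delta_bounded => //.
    - by rewrite mulr_ge0// ltW.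
    - by apply: le_trans rhod; rewrite ler_piMr.
    - move=> y z; rewrite /eball/= => py pz.
      have := edist_triangle (word_map S p x) y z; rewrite edist_sym in py; lra.
  by rewrite lee_fin -mulr_sumr ler_wpM2l ?powR_ge0//; exact: config_le.
apply: le_trans (hausdorff_delta_anti s E etad) _; apply: le_trans EW _.
by rewrite lee_fin mulrC -ler_pdivlMr// ltW.
Qed.

(** If a small ball had measure above [K * rho ^ s], its greedy packing would be so heavy that
    [ball_exhaustion] bounds the premeasure [h] of [G] by less than [h / 2]. *)
Lemma upper_regular : (0 < hausdorff_measure s G)%E -> exists2 C : R, 0 < C &
  forall x (rho : R), 0 < rho ->
  (hausdorff_measure s (G `&` eball x rho) <= (C * rho `^ s)%:E)%E.
Proof.
move=> Hpos.
have [C C0 greedy] := greedy_packing.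
have [d d0 dpos] := hausdorff_measure_gt Hpos.
have G_le : (hausdorff_measure s G <= C%:E)%E.
  apply: hausdorff_measure_le => eta eta0.
  have [W [Wl Wg _ /le_trans]] := greedy G eta (@subset_refl _ _) eta0; apply.
  by rewrite lee_fin ler_piMr ?(ltW C0)//; exact: gapped_weight_le1.
have [h h0 hE] : exists2 h : R, 0 < h & hausdorff_delta s d G = h%:E.
  have : (hausdorff_delta s d G <= C%:E)%E by exact: le_trans (hausdorff_delta_le s G d0) G_le.
  move: dpos; case: hausdorff_delta => [h| |]//; rewrite ?lee_fin ?lte_fin ?leye_eq// => h0 _.
  by exists h.
pose K := 2 * 6 `^ s * C / h.
have K0 : 0 < K by rewrite divr_gt0// !mulr_gt0// powR_gt0.
have d60 : 0 < 6 / d by rewrite divr_gt0.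
(* The second summand handles radii with [6 * rho > d], where the bound [C] on the total measure
   suffices. *)
exists (K + C * (6 / d) `^ s); first by rewrite addr_gt0// mulr_gt0// powR_gt0.
move=> x rho rho0; have rhos0 : 0 < rho `^ s by rewrite powR_gt0.
have [small|large] := leP (6 * rho) d; last first.
  apply: le_trans (hausdorff_measure_sub s (@subIsetl _ _ _)) _.
  apply: le_trans G_le _; rewrite lee_fin mulrDl.
  apply: (@le_trans _ _ (C * (6 / d) `^ s * rho `^ s)); last by rewrite lerDr ltW// mulr_gt0.
  rewrite -mulrA ler_peMr ?(ltW C0)// -powRM ?(ltW d60) ?(ltW rho0)//.
  apply: (@le_trans _ _ (1 `^ s)); first by rewrite powR1.
  apply: ge0_ler_powR; rewrite ?nnegrE//.
    by rewrite mulr_ge0 ?(ltW d60) ?(ltW rho0).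
  by rewrite mulrAC ler_pdivlMr// mul1r ltW.
apply: (@le_trans _ _ (K * rho `^ s)%:E); last first.
  by rewrite lee_fin mulrDl lerDl !mulr_ge0 ?powR_ge0// ltW.
rewrite leNgt; apply/negP => /hausdorff_measure_gt[eta' eta'0 big'].
(* [eta <= eta'] keeps the premeasure large, and [eta <= rho] keeps the copies within [2 * rho] of
   [x]. *)
pose eta := Num.min eta' rho.
have eta0 : 0 < eta by rewrite lt_min eta'0.
have eta_rho : eta <= rho by rewrite ge_min lexx orbT.
have [V [Vl Vg VE]] := greedy (G `&` eball x rho) eta (@subIsetl _ _ _) eta0.
have eta_le : eta <= eta' by rewrite ge_min lexx.
move=> /(lt_le_trans (lt_le_trans big' (hausdorff_delta_anti s _ eta_le))).
rewrite lte_fin => V_big.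
have V0 : 0 < weight V.
  by rewrite -(pmulr_rgt0 _ C0); apply: le_lt_trans V_big; rewrite mulr_ge0 ?(ltW K0) ?(ltW rhos0).
have Vx v : v \in V -> forall z, G z -> edist x (word_map S v z) <= 2 * rho.
  move=> vV z Gz; have [y [_ xy] yv] := VE _ vV.
  have := edist_triangle y x (word_map S v z); have := yv z Gz; move: xy; rewrite /eball/=; lra.
have := ball_exhaustion greedy C0 d0 rho0 small Vl Vg Vx V0.
rewrite hE lee_fin powRM// ?(ltW rho0)// ler_pdivlMr// leNgt => /negP; apply.
have : h * (K * rho `^ s) < h * (C * weight V) by rewrite ltr_pM2l.
have -> : h * (K * rho `^ s) = C * (2 * (6 `^ s * rho `^ s)) by rewrite /K; field; rewrite gt_eqF.
rewrite [ltRHS]mulrCA ltr_pM2l//; apply: le_lt_trans.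
by rewrite ler_peMl ?ler1n// mulr_ge0 ?powR_ge0.
Qed.

End Exponent.
End UpperRegularity.

(** * Dimension and regularity of the pieces *)

Section Regularity.
Context {R : realType} {n M : nat}.
Variables (S : 'I_M -> 'rV[R]_n -> 'rV[R]_n) (r : 'I_M -> R) (A : 'M[nat]_M).
Hypothesis S_sim : forall i, contracting_similarity (r i) (S i).
Hypothesis S_cube : forall i, S i @` @unit_cube R n `<=` @unit_cube R n.
Hypothesis A01 : forall i j, A i j = 0%N \/ A i j = 1%N.
Hypothesis A_irr : irreducible_mx A.
Implicit Types (u v w p : seq 'I_M) (x y : 'rV[R]_n).
Local Notation D := (cube_bound (R := R) (n := n)).
Local Notation G := (limit_set_from S A).
Local Notation F := (subshift_set S A).
Local Notation piece := (subshift_piece S A).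

Let D_gt0 : 0 < D.
Proof. exact: lt_le_trans cube_bound_ge1. Qed.

(** The [M ^ k] cylinders of length [k] have diameter at most [D * q ^ k]. If [M * q ^ N <= 1 / 2],
    their cost at exponent [N] is at most [D ^ N / 2 ^ k]. *)
Lemma subshift_set_null_exponent : has_null_exponent F.
Proof.
have [q /andP[q0 q1] qr] := ratio_le S_sim.
have [N qN] : exists N, M%:R * q ^+ N <= 2^-1.
  have qcvg : (q ^+ k @[k --> \oo] --> 0) by apply: cvg_expr; rewrite ger0_norm.
  (* The successor avoids a zero denominator for an empty alphabet. *)
  have e0 : 0 < (2 * M.+1%:R)^-1 :> R by rewrite invr_gt0 mulr_gt0.
  have /cvgrPdist_lt/(_ _ e0)[N _ /(_ N (leqnn N))] := qcvg.
  rewrite sub0r normrN ger0_norm ?exprn_ge0// => qN; exists N.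
  apply: (@le_trans _ _ (M.+1%:R * (2 * M.+1%:R)^-1)).
    by rewrite ler_pM ?exprn_ge0 ?ler_nat// ltW.
  by rewrite invfM mulrCA divff ?mulr1// pnatr_eq0.
exists N%:R => //; apply/eqP; rewrite eq_le hausdorff_measure_ge0 andbT.
apply: hausdorff_measure_le => d d0; apply/lee_addgt0Pr => e e0; rewrite add0e.
have DN0 : 0 < D ^+ N by rewrite exprn_gt0.
have [k [kd ke]] : exists k, D * q ^+ k <= d /\ D ^+ N * 2^-1 ^+ k <= e.
  have qcvg : (q ^+ k @[k --> \oo] --> 0) by apply: cvg_expr; rewrite ger0_norm.
  have hcvg : ((2^-1 : R) ^+ k @[k --> \oo] --> 0).
    by apply: cvg_expr; rewrite ger0_norm// invf_lt1// ltr1n.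
  have /cvgrPdist_lt/(_ _ (divr_gt0 d0 D_gt0))[k1 _ qk] := qcvg.
  have /cvgrPdist_lt/(_ _ (divr_gt0 e0 DN0))[k2 _ hk] := hcvg.
  exists (maxn k1 k2); split.
    have := qk (maxn k1 k2) (leq_maxl _ _); rewrite sub0r normrN ger0_norm ?exprn_ge0// => /ltW.
    by rewrite ler_pdivlMr// mulrC.
  have := hk (maxn k1 k2) (leq_maxr _ _); rewrite sub0r normrN ger0_norm ?exprn_ge0// => /ltW.
  by rewrite ler_pdivlMr// mulrC.
pose l := [seq val t | t : k.-tuple 'I_M].
apply: (@le_trans _ _ (\sum_(w <- l) (D * q ^+ k) `^ N%:R)%:E).
  apply: (@hausdorff_delta_seq _ _ _ l (fun w => word_map S w @` @unit_cube R n)) (ltW d0) _ _.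
    move=> _ [alpha _ <-]; exists (prefix_word alpha k); last exact: coding_map_nested.
    by apply/mapP; exists (mktuple (fun i => alpha i)); rewrite ?mem_enum// /=;
      rewrite /prefix_word /mkseq -val_enum_ord -map_comp.
  move=> w /mapP[t _ ->].
  apply: hausdorff_delta_bounded => //; first by rewrite mulr_ge0 ?exprn_ge0// ltW.
  move=> _ _ [x cx <-] [y cy <-]; apply: le_trans (edist_word_map_cube S_sim _ cx cy) _.
  by rewrite ler_pM2l//; have := qr t; rewrite size_tuple.
rewrite lee_fin (le_trans _ ke)// big_const_seq count_predT iter_addr_0.
rewrite size_map -cardE card_tuple card_ord.
rewrite powR_mulrn ?mulr_ge0 ?exprn_ge0 ?(ltW D_gt0)// exprMn -mulrnAr ler_pM2l//.
rewrite -exprM mulnC exprM -[leLHS]mulr_natl natrX -exprMn.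
by rewrite lerXn2r// ?nnegrE ?mulr_ge0 ?exprn_ge0 ?invr_ge0.
Qed.

(** Makes the statement about the whole limit set the case of the empty word. *)
Lemma subshift_piece_nil : piece [::] = F.
Proof.
by rewrite /subshift_piece (_ : cylinder [::] = setT) ?setIT//; apply/seteqP.
Qed.

Lemma subshift_piece_sub w : piece w `<=` F.
Proof. by move=> _ [alpha [Aalpha _] <-]; exists alpha. Qed.

Lemma limit_set_fromE a : G a = piece [:: a].
Proof.
congr (_ @` _); apply/seteqP; split=> alpha [Aalpha]; rewrite /cylinder/= /prefix_word /mkseq/=.
  by move=> <-.
by case.
Qed.

Lemma limit_set_from_nonempty a : F !=set0 -> G a !=set0.
Proof.
move=> [_ [alpha Aalpha _]]; have [L conn] := bounded_connectors A01 A_irr.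
have [w _ wa] := conn a (alpha 0%N).
by exists (coding_map S (cat_word w alpha)), (cat_word w alpha) => //; apply: wa.
Qed.

Lemma subshift_piece_copy a w : piece w !=set0 ->
  exists p, word_map S p @` G a `<=` piece w.
Proof.
move=> [_ [alpha [Aalpha walpha] _]].
have [c _ approx] := subshift_approx S_sim S_cube A01 A_irr a w.
have [|p [_ _ pa _]] := approx alpha 1 Aalpha walpha; first by rewrite ltr01/=.
exists p => _ [_ [beta abeta <-] <-]; exists (cat_word p beta); first exact: pa.
exact: coding_map_cat_word.
Qed.

(** The limit set is a finite union of the sets [G a], and each of them has a similar copy inside
    any nonempty piece. Hence all nonempty pieces share one dimension. *)
Lemma subshift_piece_null w (t : R) : 0 <= t -> piece w !=set0 ->
  hausdorff_measure t (piece w) = 0%E -> hausdorff_measure t F = 0%E.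
Proof.
move=> t0 w0 Xt0; apply/eqP; rewrite eq_le hausdorff_measure_ge0 andbT.
rewrite -[leRHS](_ : (\sum_(a <- enum 'I_M) 0)%:E = 0%E); last by rewrite big1.
apply: (@hausdorff_measure_seq _ _ _ (enum 'I_M) G) => [_ [alpha Aalpha <-]|a _].
  by exists (alpha 0%N); [rewrite mem_enum|exists alpha].
have [p /hausdorff_measure_sub0/(_ Xt0) pG0] := subshift_piece_copy a w0.
by rewrite (hausdorff_measure_image0 (ratio_gt0 S_sim p) (edist_word_map S_sim p) t0 pG0).
Qed.

Lemma hausdorff_dim_piece w : piece w !=set0 -> hausdorff_dim (piece w) = hausdorff_dim F.
Proof.
move=> w0; congr (inf _); apply/seteqP; split=> t [t0 Xt0]; split => //.
  exact: subshift_piece_null Xt0.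
exact: hausdorff_measure_sub0 (@subshift_piece_sub w) Xt0.
Qed.

Let s := hausdorff_dim F.

Let s_ge0 : 0 <= s.
Proof. exact: hausdorff_dim_ge0 subshift_set_null_exponent. Qed.

Let null_above t : s < t -> hausdorff_measure t F = 0%E.
Proof. exact: hausdorff_measure_gt_dim subshift_set_null_exponent. Qed.

Lemma limit_set_from_positive a : F !=set0 -> (0 < hausdorff_measure s F)%E ->
  (0 < hausdorff_measure s (G a))%E.
Proof.
move=> F0; rewrite lt_neqAle hausdorff_measure_ge0 andbT => Fs0.
rewrite lt_neqAle hausdorff_measure_ge0 andbT; apply: contra Fs0 => /eqP Gs0.
apply/eqP/esym; apply: (@subshift_piece_null [:: a]) => //; rewrite -limit_set_fromE//.
exact: limit_set_from_nonempty.
Qed.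

Lemma subshift_set_upper : F !=set0 -> (0 < hausdorff_measure s F)%E ->
  exists2 C : R, 0 <= C & forall x (rho : R), 0 < rho ->
  (hausdorff_measure s (F `&` eball x rho) <= (C * rho `^ s)%:E)%E.
Proof.
move=> F0 Fs0.
have /choice[C CP] a : exists C : R, 0 < C /\ forall x (rho : R), 0 < rho ->
    (hausdorff_measure s (G a `&` eball x rho) <= (C * rho `^ s)%:E)%E.
  have [t st|||C C0 CG] := @upper_regular _ _ _ S r A S_sim S_cube A01 A_irr a s s_ge0.
  - apply: hausdorff_measure_sub0 (null_above st).
    by rewrite limit_set_fromE; exact: subshift_piece_sub.
  - exact: limit_set_from_nonempty.
  - exact: limit_set_from_positive.
  by exists C.
exists (\sum_(a <- enum 'I_M) C a); first by apply: sumr_ge0 => a _; exact: ltW (CP a).1.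
move=> x rho rho0; rewrite mulr_suml.
apply: (@hausdorff_measure_seq _ _ _ (enum 'I_M) (fun a => G a `&` eball x rho)).
  move=> _ [[alpha Aalpha <-] xa].
  by exists (alpha 0%N); [rewrite mem_enum|split => //; exists alpha].
by move=> a _; exact: (CP a).2.
Qed.

Lemma diam_piece w : (diam (piece w) <= D%:E)%E.
Proof.
apply: diam_le => [|_ _ [alpha _ <-] [beta _ <-]]; first by rewrite lee_fin ltW.
by rewrite lee_fin; apply: edist_cube; exact: coding_map_cube.
Qed.

(** Approximating at scale [rho / D] places a copy of [G a], of ratio at least [c / D * rho], inside
    both the piece and the ball. *)
Lemma subshift_piece_lower w : piece w !=set0 -> (0 < hausdorff_measure s F)%E ->
  exists2 c : R, 0 < c & forall x (rho : R), 0 < rho -> (rho%:E <= diam (piece w))%E ->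
  piece w x -> ((c * rho `^ s)%:E <= hausdorff_measure s (piece w `&` eball x rho))%E.
Proof.
move=> w0 Fs0; have F0 : F !=set0 by have [x wx] := w0; exists x; exact: subshift_piece_sub wx.
have [_ [alpha0 _ _]] := F0; pose a := alpha0 0%N.
have [h h0 hG] : exists2 h : R, 0 < h & (h%:E <= hausdorff_measure s (G a))%E.
  have := limit_set_from_positive a F0 Fs0; case: hausdorff_measure => [h| |]//.
    by rewrite lte_fin; exists h.
  by exists 1; rewrite ?leey.
have [c /andP[c0 c1] approx] := subshift_approx S_sim S_cube A01 A_irr a w.
have cD0 : 0 < c / D by rewrite divr_gt0.
exists ((c / D) `^ s * h); first by rewrite mulr_gt0 ?powR_gt0.
move=> x rho rho0 rhow [alpha [Aalpha walpha] alphax].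
have rhoD : rho <= D by rewrite -lee_fin (le_trans rhow)// diam_piece.
have [|p [/andP[cp _] _ pa px]] := approx alpha (rho / D) Aalpha walpha.
  by rewrite divr_gt0//= ler_pdivrMr// mul1r.
have sub : word_map S p @` G a `<=` piece w `&` eball x rho.
  move=> _ [y Gy <-]; split; last first.
    have cy := limit_set_from_cube S_sim S_cube Gy.
    by rewrite /eball/= -alphax (le_trans (px _ cy))// mulrCA divff ?mulr1// gt_eqF.
  have [beta abeta <-] := Gy; exists (cat_word p beta); first exact: pa.
  exact: coding_map_cat_word.
apply: le_trans (hausdorff_measure_sub s sub).
have rp0 := ratio_gt0 S_sim p.
apply: le_trans (hausdorff_measure_image rp0 (edist_word_map S_sim p) (G a) s_ge0).
apply: (@le_trans _ _ ((ratio r p `^ s)%:E * h%:E)%E); last first.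
  by rewrite lee_pmul2l// lte_fin powR_gt0.
rewrite -EFinM lee_fin mulrAC ler_pM2r// -powRM ?(ltW cD0) ?(ltW rho0)//.
apply: ge0_ler_powR; rewrite ?nnegrE ?(ltW rp0)//; first by rewrite mulr_ge0 ?(ltW cD0) ?(ltW rho0).
by rewrite mulrAC -mulrA.
Qed.

Lemma positive_measure_regular w :
  (0 < hausdorff_measure s (piece w))%E -> ahlfors_regular (piece w).
Proof.
move=> ws0; have w0 : piece w !=set0.
  by apply/set0P/negP => /eqP w0; move: ws0; rewrite w0 hausdorff_measure_set0 ltxx.
have Fs0 : (0 < hausdorff_measure s F)%E.
  exact: lt_le_trans ws0 (hausdorff_measure_sub s (@subshift_piece_sub w)).
have F0 : F !=set0 by have [x wx] := w0; exists x; exact: subshift_piece_sub wx.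
have [C C0 upper] := subshift_set_upper F0 Fs0.
have [c c0 lower] := subshift_piece_lower w0 Fs0.
rewrite /ahlfors_regular hausdorff_dim_piece// -/s; split => //.
  by rewrite (le_lt_trans (diam_piece w))// ltry.
have c'0 : 0 < c^-1 by rewrite invr_gt0.
(* This constant is at least 1 and at least [C], and its inverse is at most [c]. *)
exists (1 + C + c^-1); first by rewrite -addrA lerDl addr_ge0// ltW.
move=> rho x rho0 rhow wx; split.
  apply: le_trans (lower x rho rho0 rhow wx); rewrite lee_fin ler_wpM2r ?powR_ge0//.
  by rewrite -[leRHS]invrK lef_pV2 ?posrE//; lra.
apply: (@le_trans _ _ (C * rho `^ s)%:E); last first.
  by rewrite lee_fin ler_wpM2r ?powR_ge0//; lra.
apply: le_trans (upper x rho rho0); apply: hausdorff_measure_sub.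
by apply: setSI; exact: subshift_piece_sub.
Qed.

Lemma regular_positive_measure w :
  ahlfors_regular (piece w) -> (0 < hausdorff_measure s (piece w))%E.
Proof.
move=> [w0 wdiam [c c1 reg]]; have dimw := hausdorff_dim_piece w0; rewrite dimw -/s in reg.
have [x wx] := w0.
(* For diameter 0 no radius is admissible and regularity gives no bound. The piece is then a point,
   so [s = 0], and every cover costs at least 1 because a nonempty set contributes 1. *)
have := diam_ge0 (piece w); rewrite le_eqVlt => /orP[/eqP diam0|diam_pos].
  have pt : (forall y z, piece w y -> piece w z -> edist y z <= 0).
    by move=> y z wy wz; have := le_diam wy wz; rewrite -diam0 lee_fin.
  have s0 : s = 0.
    apply/eqP; rewrite eq_le s_ge0 andbT; apply/ler_addgt0Pr => e e0; rewrite add0r.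
    rewrite /s -dimw; apply: ge_inf; first by exists 0 => t [].
    split; first exact: ltW.
    apply/eqP; rewrite eq_le hausdorff_measure_ge0 andbT.
    apply: hausdorff_measure_le => d d0.
    have := hausdorff_delta_bounded (ltW e0) (lexx 0) (ltW d0) pt.
    by rewrite powR0// gt_eqF.
  rewrite s0; apply: (@lt_le_trans _ _ 1%E) => //.
  apply: le_trans (hausdorff_delta_le 0 _ ltr01).
  apply: le_ereal_inf_tmp => _ [U [wU _] <-].
  have [k _ Ukx] := wU x wx.
  rewrite (nneseriesD1 (n := k))//=; last by move=> j _; exact: diam_pow_ge0.
  rewrite diam_pow_neq0; last by exists x.
  by rewrite poweRe0 leeDl// nneseries_ge0// => j _ _; exact: diam_pow_ge0.
have diam_fin : diam (piece w) \is a fin_num by rewrite ge0_fin_numE ?diam_ge0.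
have rho0 : 0 < fine (diam (piece w)) by rewrite fine_gt0// diam_pos.
have [|lower _] := reg _ x rho0 _ wx; first by rewrite fineK.
apply: lt_le_trans (hausdorff_measure_sub s (@subIsetl _ _ (eball x (fine (diam (piece w)))))).
apply: lt_le_trans lower; rewrite lte_fin mulr_gt0 ?powR_gt0// invr_gt0.
exact: lt_le_trans c1.
Qed.

End Regularity.

Theorem corollary3p1 (R : realType) (n M : nat)
    (S : 'I_M -> 'rV[R]_n -> 'rV[R]_n) (r : 'I_M -> R) (A : 'M[nat]_M)
    (S_sim : forall i, contracting_similarity (r i) (S i))
    (S_cube : forall i, S i @` @unit_cube R n `<=` @unit_cube R n)
    (A01 : forall i j, A i j = 0%N \/ A i j = 1%N)
    (A_irr : irreducible_mx A) :
  let s := hausdorff_dim (subshift_set S A) in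
  ((0 < hausdorff_measure s (subshift_set S A))%E <->
     ahlfors_regular (subshift_set S A)) /\
  (forall w : seq 'I_M, w <> [::] ->
     ((0 < hausdorff_measure s (subshift_piece S A w))%E <->
        ahlfors_regular (subshift_piece S A w))).
Proof.
have regular_iff w : (0 < hausdorff_measure (hausdorff_dim (subshift_set S A))
    (subshift_piece S A w))%E <-> ahlfors_regular (subshift_piece S A w).
  by split; [exact: (positive_measure_regular S_sim)|exact: (regular_positive_measure S_sim)].
split=> [|w _]; last exact: regular_iff.
by have := regular_iff [::]; rewrite subshift_piece_nil.
Qed.
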